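(* If $U_1,U_2\in O_\epsilon(U_{m2})$ and $U_3\in O_\epsilon(U_a)$ with $$\{U_1,U_2\}=(0,\alpha_2,\alpha_3,\alpha_4),\qquad \{U_2,U_3\}=(\beta_1,\beta_2,\beta_3,\sigma_4),$$ then there exists a unique $(\delta_1,\delta_2,\delta_3,\sigma_4')$ such that $\{U_1,U_3\}=(\delta_1,\delta_2,\delta_3,\sigma_4')$. Moreover, $$\delta_1=\beta_1+K_{4sb1}\alpha_4+O(1)\Delta''',\qquad \delta_2=\beta_2+\alpha_2+K_{4sb2}\alpha_4+O(1)\Delta''',$$ $$\delta_3=\beta_3+\alpha_3+K_{4sb3}\alpha_4+O(1)\Delta''',\qquad \sigma_4'=\sigma_4+K_{4sb4}\alpha_4+O(1)\Delta''',$$ where $$\Delta'''=|\beta_1|(|\alpha_2|+|\alpha_3|),\qquad |K_{4sb1}|<1,\qquad \sum_{j=2}^4|K_{4sbj}|\le M.$$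
   Context: Fix $\gamma>1$. For $U=(u,v,p,\rho)$ with $p,\rho>0$ put $c=\sqrt{\gamma p/\rho}$, $h=\frac{\gamma p}{(\gamma-1)\rho}$, $$W(U)=\big(\rho u,\rho u^2+p,\rho uv,\rho u(h+\tfrac{u^2+v^2}{2})\big),\quad H(U)=\big(\rho v,\rho uv,\rho v^2+p,\rho v(h+\tfrac{u^2+v^2}{2})\big).$$ The steady full Euler system is $W(U)_x+H(U)_y=0$. For $u>c$ its eigenvalues are $\lambda_j=\frac{uv+(-1)^jc\sqrt{u^2+v^2-c^2}}{u^2-c^2}$ ($j=1,4$), $\lambda_2=\lambda_3=v/u$, with eigenvectors $\mathbf r_j=\kappa_j(-\lambda_j,1,\rho(\lambda_ju-v),\rho(\lambda_ju-v)/c^2)^\top$ ($j=1,4$, $\kappa_j$ chosen so that $\mathbf r_j\cdot\nabla\lambda_j=1$), $\mathbf r_2=(u,v,0,0)^\top$, $\mathbf r_3=(0,0,0,\rho)^\top$. Shocks. A $j$-shock ($j=1,4$) of slope (speed) $s$ between $U_-$ (below) and $U_+$ (above) satisfies $s(W(U_+)-W(U_-))=H(U_+)-H(U_-)$ and the entropy conditions $\lambda_j(U_+)<s<\lambda_j(U_-)$, with $s<\lambda_2(U_-)$ if $j=1$ and $\lambda_2(U_+)<s$ if $j=4$. Elementary waves. For $j=1,4$, $\alpha\mapsto\Phi_j(\alpha;U)$ is a fixed (Lax) $C^2$ parametrization of the states that lie above a state $U$ and are connected to it by a $j$-rarefaction wave ($\alpha>0$) or a $j$-shock ($\alpha<0$),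 with $\Phi_j(0;U)=U$, $\partial_\alpha\Phi_j(0;U)=\mathbf r_j(U)$; $\Phi_2(\alpha;U)=(ue^\alpha,ve^\alpha,p,\rho)$, $\Phi_3(\alpha;U)=(u,v,p,\rho e^\alpha)$; $\Phi(\alpha_4,\alpha_3,\alpha_2,\alpha_1;U)=\Phi_4(\alpha_4;\Phi_3(\alpha_3;\Phi_2(\alpha_2;\Phi_1(\alpha_1;U))))$. Background states. $U_{m2}=(u_{m2},0,p_{m2},\rho_{m2})$ and $U_a=(u_a,v_a,p_a,\rho_a)$ are fixed, both with $u>c$, and connected ($U_{m2}$ below, $U_a$ above) by a strong $4$-shock of speed $\sigma_{40}$. For $V$ near $U_a$ and $\sigma_4$ near $\sigma_{40}$, $G_4(\sigma_4;V)$ denotes the unique state near $U_{m2}$ connected to $V$ from below by a $4$-shock of speed $\sigma_4$, so $G_4(\sigma_{40};U_a)=U_{m2}$. Notation. For two states near the same background state, $\{U,V\}=(\alpha_1,\alpha_2,\alpha_3,\alpha_4)$ means $V=\Phi(\alpha_4,\alpha_3,\alpha_2,\alpha_1;U)$ with small $\alpha_i$. For $U$ near $U_{m2}$ and $V$ near $U_a$, $\{U,V\}=(\beta_1,\beta_2,\beta_3,\sigma_4)$ means $\Phi(0,\beta_3,\beta_2,\beta_1;U)=G_4(\sigma_4;V)$ with $\sigma_4$ near $\sigma_{40}$ and small $\beta_i$. $O_\epsilon(\cdot)$ denotes sufficiently small neighborhoods, $M>0$ a large constant, both depending only on the system and the background states; $O(1)$ denotes a quantity bounded in absolute value by $M$;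 uniqueness is within these parameter neighborhoods. The coefficients $K$ may depend on the given states and wave strengths. *)

(* Defs.v *)
From HB Require Import structures.
From mathcomp Require Import all_boot all_order all_algebra.
From mathcomp Require Import all_classical all_reals all_analysis.

Set Implicit Arguments.
Unset Strict Implicit.
Unset Printing Implicit Defensive.

Import Order.TTheory GRing.Theory Num.Theory.
Import numFieldNormedType.Exports.

Local Open Scope classical_set_scope.
Local Open Scope ring_scope.

Section smoothness.
Context {R : realType} {X Y : normedModType R}.

(* Meant for finite-dimensional X, where continuity of every directional
   derivative amounts to continuity of the Frechet differential. *)
Definition C1_on (A : set X) (f : X -> Y) : Prop :=
  forall x, A x ->
    differentiable f x /\ forall v, {for x, continuous ('D_v f)}.

Definition C2_on (A : set X) (f : X -> Y) : Prop :=
  C1_on A f /\ forall v, C1_on A ('D_v f).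

End smoothness.

Section euler.
Context {R : realType}.

(* A state is the row vector (u, v, p, rho). *)
Notation state := 'rV[R]_4.

Definition vec4 (a b c d : R) : state := \row_(i < 4) [:: a; b; c; d]`_i.

Definition velx (U : state) : R := U 0 (inord 0).
Definition vely (U : state) : R := U 0 (inord 1).
Definition pres (U : state) : R := U 0 (inord 2).
Definition dens (U : state) : R := U 0 (inord 3).

Variable gamma : R.

Definition sound (U : state) : R := Num.sqrt (gamma * pres U / dens U).

Definition enthalpy (U : state) : R :=
  gamma * pres U / ((gamma - 1) * dens U).

Definition supersonic (U : state) : Prop :=
  [/\ 0 < pres U, 0 < dens U & sound U < velx U].

Definition Wflux (U : state) : state :=
  let: (u, v, p, rho) := (velx U, vely U, pres U, dens U) in
  vec4 (rho * u) (rho * u ^+ 2 + p) (rho * u * v)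
       (rho * u * (enthalpy U + (u ^+ 2 + v ^+ 2) / 2)).

Definition Hflux (U : state) : state :=
  let: (u, v, p, rho) := (velx U, vely U, pres U, dens U) in
  vec4 (rho * v) (rho * u * v) (rho * v ^+ 2 + p)
       (rho * v * (enthalpy U + (u ^+ 2 + v ^+ 2) / 2)).

(* The eigenvalue lambda_j, for j = 1 or 4 only. *)
Definition lambda (j : nat) (U : state) : R :=
  let: (u, v, c) := (velx U, vely U, sound U) in
  (u * v + (-1) ^+ j * c * Num.sqrt (u ^+ 2 + v ^+ 2 - c ^+ 2))
    / (u ^+ 2 - c ^+ 2).

(* The double eigenvalue lambda_2 = lambda_3. *)
Definition lambda2 (U : state) : R := vely U / velx U.

Definition dir (j : nat) (U : state) : state :=
  let: (u, v, rho, c, l) := (velx U, vely U, dens U, sound U, lambda j U) in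
  vec4 (- l) 1 (rho * (l * u - v)) (rho * (l * u - v) / c ^+ 2).

(* kappa_j makes r_j . grad lambda_j = 1. *)
Definition kappa (j : nat) (U : state) : R :=
  (\sum_(i < 4) dir j U 0 i * 'D_(delta_mx 0 i) (lambda j) U)^-1.

Definition eigvec (j : nat) (U : state) : state := kappa j U *: dir j U.

(* U is the state below the wave and V the state above it. *)
Definition shock (j : nat) (s : R) (U V : state) : Prop :=
  [/\ supersonic U, supersonic V,
      s *: (Wflux V - Wflux U) = Hflux V - Hflux U,
      lambda j V < s < lambda j U
    & (j = 1%N -> s < lambda2 U) /\ (j = 4%N -> lambda2 V < s)].

(* The wave is the self-similar solution w (y / x): since
   r_j . grad lambda_j = 1, the integral curve of r_j is parametrized by
   lambda_j itself. *)
Definition rarefaction (j : nat) (U V : state) : Prop :=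
  lambda j U < lambda j V /\
  exists w : R -> state,
    [/\ w (lambda j U) = U, w (lambda j V) = V
      & forall xi : R, lambda j U <= xi <= lambda j V ->
          [/\ supersonic (w xi), lambda j (w xi) = xi
            & is_derive xi (1 : R) w (eigvec j (w xi))]].

(* Phi alpha U is a C^2 parametrization, for U near U0 and alpha near 0, of
   the nearby states above U that are connected to U by a j-wave. *)
Definition lax_curve (j : nat) (U0 : state) (Phi : R -> state -> state) :
    Prop :=
  exists a r : R, [/\ 0 < a, 0 < r,
    C2_on [set x : R * state | `|x.1| < a /\ `|x.2 - U0| < r]
          (fun x => Phi x.1 x.2)
  & forall U, `|U - U0| < r ->
    [/\ Phi 0 U = U,
        is_derive (0 : R) (1 : R) (fun alpha => Phi alpha U) (eigvec j U),
        forall alpha, 0 < alpha < a -> rarefaction j U (Phi alpha U),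
        forall alpha, - a < alpha < 0 -> exists s, shock j s U (Phi alpha U)
      & forall V, `|V - U0| < r ->
          (rarefaction j U V ->
             exists2 alpha, 0 < alpha < a & V = Phi alpha U) /\
          ((exists s, shock j s U V) ->
             exists2 alpha, - a < alpha < 0 & V = Phi alpha U)]].

Definition Phi2 (alpha : R) (U : state) : state :=
  vec4 (velx U * expR alpha) (vely U * expR alpha) (pres U) (dens U).

Definition Phi3 (alpha : R) (U : state) : state :=
  vec4 (velx U) (vely U) (pres U) (dens U * expR alpha).

Definition waves (Phi1 Phi4 : R -> state -> state)
    (alpha4 alpha3 alpha2 alpha1 : R) (U : state) : state :=
  Phi4 alpha4 (Phi3 alpha3 (Phi2 alpha2 (Phi1 alpha1 U))).

(* For V near Ua and s near s0, G s V is the unique state near Um connected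
   to V from below by a 4-shock of speed s. *)
Definition strong_shock_map (Um Ua : state) (s0 : R)
    (G : R -> state -> state) : Prop :=
  exists r rm : R, [/\ 0 < r, 0 < rm
  & forall (s : R) (V : state), `|s - s0| < r -> `|V - Ua| < r ->
    [/\ `|G s V - Um| < rm, shock 4 s (G s V) V
      & forall U, `|U - Um| < rm -> shock 4 s U V -> U = G s V]].

(* {U, V} = (alpha1, alpha2, alpha3, alpha4) near one background state. *)
Definition weak_waves (Phi1 Phi4 : R -> state -> state) (eta : R)
    (U V : state) (q : R * R * R * R) : Prop :=
  let: (alpha1, alpha2, alpha3, alpha4) := q in
  [/\ `|alpha1| < eta, `|alpha2| < eta, `|alpha3| < eta, `|alpha4| < eta
    & V = waves Phi1 Phi4 alpha4 alpha3 alpha2 alpha1 U].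

(* {U, V} = (beta1, beta2, beta3, s) across the strong 4-shock. *)
Definition strong_waves (Phi1 Phi4 G : R -> state -> state) (s0 eta : R)
    (U V : state) (q : R * R * R * R) : Prop :=
  let: (beta1, beta2, beta3, s) := q in
  [/\ `|beta1| < eta, `|beta2| < eta, `|beta3| < eta, `|s - s0| < eta
    & waves Phi1 Phi4 0 beta3 beta2 beta1 U = G s V].

End euler.

(* Main.v *)
(* Near the background states the strong shock map is just the solution of
   S(sigma, U) = S(sigma, V), where S(sigma, U) = sigma W(U) - H(U), because the
   other shock conditions are open. Hence (delta_1, delta_2, delta_3, sigma_4')
   is a zero of a residual F which is strictly differentiable at the background
   point, with an invertible differential L. Existence is the contraction
   principle and uniqueness is the injectivity of L.

   Invertibility is explicit. At v = 0 the fields 1 and 4 are mirror images, so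
   kappa_1 = kappa_4; eliminating the 2- and 3-waves from L K = S'(U_m2) r_4
   leaves K_1 (s + l) (A + B) = (s - l) (A - B) with A, B > 0, s = sigma_40 > 0
   and l = lambda_4(U_m2) > 0, whence |K_1| < 1. Positivity of A follows from
   positivity of the pressure of U_a together with u > c at U_m2.

   For the expansion, q0 = (beta_1, beta_2 + alpha_2, beta_3 + alpha_3, sigma_4)
   is an approximate zero: F(q0) = - alpha_4 S'(U_m2) r_4 + o(alpha_4) plus a
   term of order |beta_1| (|alpha_2| + |alpha_3|), because Phi_2 and Phi_3 are
   commuting linear flows and the commutator of the C^2 map Phi_1 with them
   vanishes whenever either factor is trivial. *)

Require Import Defs.
From HB Require Import structures.
From mathcomp Require Import all_boot all_order all_algebra.
From mathcomp Require Import all_classical all_reals all_analysis.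
From mathcomp Require Import ring lra.

Import Order.TTheory GRing.Theory Num.Theory.
Import numFieldNormedType.Exports.

Local Open Scope ring_scope.
Local Open Scope classical_set_scope.

Set Implicit Arguments.
Unset Strict Implicit.
Unset Printing Implicit Defensive.

(** * Strict differentiability of C^1 maps *)

Section differentials.
Context {R : realType}.

(** The coefficients [K_j] may depend on the states and strengths, so an error o(alpha_4) need not
    be estimated further: it is absorbed into them, and the gap between 1 and the background value
    of [|K_1|] leaves room for it. Hence the 4-wave is treated by strict differentiability at the
    single background point, and no derivative at a nearby state has to be controlled. A product
    such as |beta_1| (|alpha_2| + |alpha_3|) cannot come out of a first-order estimate; there C^2
    regularity enters, as a Lipschitz bound on the strength derivative of Phi_1. Strictness, the
    comparison of two arbitrary points near the base, lets one estimate serve the contraction, the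
    uniqueness and the expansion. The states U and V are mere parameters of the residual, and all
    radii are chosen before them, so the neighbourhoods depend only on the background. *)

Lemma coord_le_norm n (x : 'rV[R]_n) i : `|x 0 i| <= `|x|.
Proof.
by rewrite [leRHS]/Num.norm /= mx_normrE; apply/bigmax_geP; right; exists (0, i).
Qed.

Lemma entry_dist_le n (x y : 'rV[R]_n) i : `|x 0 i - y 0 i| <= `|x - y|.
Proof. by have := coord_le_norm (x - y) i; rewrite !mxE. Qed.

Lemma row_norm_le n (x : 'rV[R]_n) e :
  0 <= e -> (forall i, `|x 0 i| <= e) -> `|x| <= e.
Proof.
move=> e0 xe; rewrite [leLHS]/Num.norm /= mx_normrE; apply/bigmax_leP.
by split=> // -[i j] _ /=; rewrite ord1.
Qed.

Lemma is_derive_line (X Y : normedModType R) (f : X -> Y) y w (t : R) :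
  derivable f (y + t *: w) w ->
  is_derive t 1 (fun t : R => f (y + t *: w)) ('D_w f (y + t *: w)).
Proof.
move=> df.
have E : (fun h : R => h^-1 *: (((fun t : R => f (y + t *: w)) \o shift t) (h *: 1)
    - f (y + t *: w))) =
  (fun h : R => h^-1 *: ((f \o shift (y + t *: w)) (h *: w) - f (y + t *: w))).
  apply/funext => h /=; congr (_ *: (f _ - _)).
  by rewrite [h *: 1]mulr1 scalerDl addrCA.
by split; [rewrite /derivable E|rewrite /derive E].
Qed.

Lemma mvt_line (X : normedModType R) m (f : X -> 'rV[R]_m) x y i :
  (forall t : R, 0 <= t <= 1 -> derivable f (y + t *: (x - y)) (x - y)) ->
  exists2 t : R, 0 <= t <= 1 &
    f x 0 i - f y 0 i = ('D_(x - y) f (y + t *: (x - y))) 0 i.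
Proof.
move=> df; set w := x - y.
have dg (t : R) : 0 <= t <= 1 ->
    is_derive t 1 (fun t : R => f (y + t *: w) 0 i) ('D_w f (y + t *: w) 0 i).
  move=> t01; have [d1 d2] := is_derive_line (df _ t01).
  split; first by have /derivable_mxP := d1; apply.
  by rewrite -d2 derive_mx // mxE.
have [||c] := @MVT_segment R (fun t : R => f (y + t *: w) 0 i)
    (fun t => 'D_w f (y + t *: w) 0 i) 0 1 ler01.
- by move=> t; rewrite in_itv /= => /andP[t0 t1]; apply: dg; rewrite !ltW.
- apply: derivable_within_continuous => t.
  by rewrite in_itv /= => /dg[].
rewrite in_itv /= => c01 e; exists c => //.
by rewrite scale1r scale0r addr0 subr0 mulr1 (addrC y) subrK in e.
Qed.

Lemma near_ball (V : normedModType R) (a : V) (P : V -> Prop) :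
  (\forall x \near a, P x) ->
  exists2 r : R, 0 < r & forall x, `|x - a| < r -> P x.
Proof.
move=> /nbhs_normP[r /= r0 rP]; exists r => // x xa; apply: rP => /=.
by rewrite /ball_ /= distrC.
Qed.

Lemma ball_segment (V : normedModType R) (a x y : V) (r t : R) :
  0 <= t <= 1 -> `|x - a| < r -> `|y - a| < r ->
  `|y + t *: (x - y) - a| < r.
Proof.
move=> /andP[t0 t1] xa ya.
have -> : y + t *: (x - y) - a = (1 - t) *: (y - a) + t *: (x - a).
  rewrite !scalerBl !scalerBr !scale1r.
  by rewrite opprB -[RHS]addrA (addrC (_ - t *: y)) subrKA addrAC.
apply: le_lt_trans (ler_normD _ _) _; rewrite !normrZ.
rewrite (ger0_norm t0) ger0_norm ?subr_ge0 //.
(* Strictness is taken from the [x] term, so [t = 0] is handled separately. *)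
have [t00|tp] := eqVneq t 0.
  by rewrite t00 subr0 mul1r mul0r addr0.
have : (1 - t) * `|y - a| <= (1 - t) * r.
  by rewrite ler_wpM2l ?subr_ge0 // ltW.
have : t * `|x - a| < t * r by rewrite ltr_pM2l // lt_neqAle eq_sym tp.
lra.
Qed.

Lemma pair_norm_max (V W : normedModType R) (x : V * W) (e : R) :
  (`|x| <= e) = (`|x.1| <= e) && (`|x.2| <= e).
Proof. by rewrite prod_normE ge_max. Qed.

(** [C1_on] gives continuity of each directional derivative separately; uniformity in the direction
    comes from expanding ['D_w f] over the finite basis [b0], [b k]. The mean value theorem is
    applied entry by entry, because the intermediate point depends on the entry, and the error is
    the oscillation of ['D_w f] on the ball. *)
Lemma C1_strict n m (A : set (R * 'rV[R]_n)) (f : R * 'rV[R]_n -> 'rV[R]_m)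
    (a : R * 'rV[R]_n) :
  C1_on A f -> (\forall x \near a, A x) ->
  forall e : R, 0 < e -> exists2 r : R, 0 < r &
    forall x y : R * 'rV[R]_n, `|x - a| < r -> `|y - a| < r ->
    `|f x - f y - 'D_(x - y) f a| <= e * `|x - y|.
Proof.
move=> C1f nA e e0.
have Aa : A a := nbhs_singleton nA.
pose b k : R * 'rV[R]_n := (0, delta_mx 0 k).
pose b0 : R * 'rV[R]_n := (1, 0).
have De w z : A z -> 'D_w f z =
    w.1 *: 'D_b0 f z + \sum_k w.2 0 k *: 'D_(b k) f z.
  move=> /C1f[df _]; rewrite deriveE //.
  have {1}-> : w = w.1 *: b0 + \sum_k w.2 0 k *: b k.
    case: w => w1 w2 /=; have -> : \sum_k w2 0 k *: b k = (0, w2).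
      rewrite [in RHS](row_sum_delta w2).
      elim/big_rec2: _ => [//|k p q _ ->].
      by congr (_, _); rewrite /= ?scaler0 ?addr0.
    by congr (_, _); rewrite /= ?scaler0 ?add0r ?addr0 // [_ *: _]mulr1.
  rewrite linearD linearZ linear_sum deriveE //; congr (_ + _).
  by apply: eq_bigr => k _; rewrite linearZ deriveE.
(* The number of basis directions: one for the scalar, [n] for the vector. *)
pose N : R := n.+1%:R.
have N0 : 0 < N by rewrite ltr0n.
have eN : 0 < e / N by rewrite divr_gt0.
have : \forall x \near a, (A x /\ `|'D_b0 f x - 'D_b0 f a| <= e / N) /\
    forall k, `|'D_(b k) f x - 'D_(b k) f a| <= e / N.
  apply: filterI; first apply: filterI => //.
    by have [_ /(_ b0) /cvgr_distC_le] := C1f _ Aa; apply.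
  apply: (@filter_forall _ _
    (fun k x => `|'D_(b k) f x - 'D_(b k) f a| <= e / N) (nbhs a)) => k.
  by have [_ /(_ (b k)) /cvgr_distC_le] := C1f _ Aa; apply.
move=> /near_ball[r r0 H]; exists r => // x y xa ya.
apply: row_norm_le; first by rewrite mulr_ge0 // ltW.
move=> i; set w := x - y.
rewrite [leLHS](_ : _ = `|(f x 0 i - f y 0 i) - 'D_w f a 0 i|); last first.
  by rewrite !mxE.
have [|t t01 ->] := @mvt_line _ m f x y i.
  move=> t t01; apply: diff_derivable.
  by have [[/C1f[]]] := H _ (ball_segment t01 xa ya).
have [[Az D0z] Dz] := H _ (ball_segment t01 xa ya).
rewrite -/w in Az D0z Dz *; set z := y + _ in Az D0z Dz *.
rewrite [X in `|X|](_ : _ = ('D_w f z - 'D_w f a) 0 i); last by rewrite !mxE.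
apply: le_trans (coord_le_norm _ _) _.
rewrite (De w z) // (De w a) // opprD addrACA -scalerBr -sumrB.
have -> : e * `|w| = e / N * `|w| + \sum_(k < n) e / N * `|w|.
  by rewrite sumr_const card_ord -mulrS -mulr_natr -/N mulrAC divfK // gt_eqF.
have := lexx `|w|; rewrite pair_norm_max => /andP[w1 w2].
apply: le_trans (ler_normD _ _) (lerD _ _).
  by rewrite normrZ mulrC ler_pM.
have wk k : `|w.2 0 k| <= `|w| by exact: le_trans (coord_le_norm _ _) w2.
apply: le_trans (ler_norm_sum _ _ _) _; apply: ler_sum => k _.
rewrite -scalerBr normrZ [leLHS]mulrC.
exact: (ler_pM (normr_ge0 _) (normr_ge0 _) (Dz k) (wk k)).
Qed.

End differentials.

(** * Lipschitz bounds and inverses of linear maps *)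

Section bounds.
Context {R : realType}.

Lemma continuous_linear_le (V W : normedModType R) (f : {linear V -> W}) :
  continuous f -> exists2 C : R, 0 < C & forall x, `|f x| <= C * `|x|.
Proof.
move=> /(_ 0) /(continuous_linear_bounded 0) /linear_boundedP [M [_ MC]].
exists (Num.max 0 M + 1); first by rewrite ltr_wpDl // le_max lexx.
move=> x; apply: MC; rewrite (le_lt_trans (y := Num.max 0 M)) //.
  by rewrite le_max lexx orbT.
by rewrite ltrDl.
Qed.

Lemma C1_lipschitz n m (A : set (R * 'rV[R]_n)) (f : R * 'rV[R]_n -> 'rV[R]_m)
    (a : R * 'rV[R]_n) :
  C1_on A f -> (\forall x \near a, A x) ->
  exists C r : R, [/\ 0 < C, 0 < r &
    forall x y : R * 'rV[R]_n, `|x - a| < r -> `|y - a| < r ->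
    `|f x - f y| <= C * `|x - y|].
Proof.
move=> C1f nA; have [df _] := C1f _ (nbhs_singleton nA).
have [C C0 dC] := continuous_linear_le (diff_continuous df).
have [r r0 H] := C1_strict C1f nA ltr01.
exists (1 + C), r; split=> //; first by rewrite addr_gt0.
move=> x y xa ya; rewrite mulrDl.
have /lerD := H x y xa ya; move=> /(_ _ _ (dC (x - y))).
rewrite -deriveE //; apply: le_trans.
by rewrite -{1}(subrK ('D_(x - y) f a) (f x - f y)) ler_normD.
Qed.

Lemma mulmx_norm_le n m (A : 'M[R]_(n, m)) :
  exists2 C : R, 0 < C & forall x : 'rV[R]_n, `|x *m A| <= C * `|x|.
Proof.
pose C := 1 + \sum_j \sum_i `|A j i|.
have sum0 : 0 <= \sum_j \sum_i `|A j i|.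
  by apply: sumr_ge0 => j _; exact: sumr_ge0.
have C0 : 0 < C by rewrite ltr_pwDl.
exists C => // {}x; apply: row_norm_le => [|i].
  by rewrite mulr_ge0 // ltW.
rewrite mxE; apply: le_trans (ler_norm_sum _ _ _) _.
apply: (@le_trans _ _ (\sum_j `|A j i| * `|x|)).
  apply: ler_sum => j _; rewrite normrM mulrC.
  by rewrite ler_wpM2l ?coord_le_norm.
rewrite -mulr_suml; apply: ler_wpM2r => //.
rewrite /C ler_wpDl //; apply: ler_sum => j _.
by rewrite (bigD1 i) //= lerDl sumr_ge0.
Qed.

(** In finite dimension a trivial kernel makes the matrix of [f] invertible, and the inverse matrix
    is bounded. *)
Lemma injective_linear_inv n (f : 'rV[R]_n -> 'rV[R]_n) :
  linear f -> (forall x, f x = 0 -> x = 0) ->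
  exists g : {linear 'rV[R]_n -> 'rV[R]_n}, [/\ cancel f g, cancel g f &
    exists2 C : R, 0 < C & forall x, `|g x| <= C * `|x|].
Proof.
move=> flin f0.
pose fL : {linear 'rV[R]_n -> 'rV[R]_n} :=
  HB.pack f (GRing.isLinear.Build R 'rV[R]_n 'rV[R]_n *:%R f flin).
pose A := lin1_mx fL.
have AE x : x *m A = f x by rewrite mul_rV_lin1.
have uA : A \in unitmx.
  by rewrite -row_free_unit; apply: inj_row_free => v; rewrite AE => /f0.
exists (mulmxr (invmx A)); split => [x|x|] /=.
- by rewrite -AE mulmxK.
- by rewrite -AE mulmxKV.
exact: mulmx_norm_le.
Qed.

End bounds.

(** * First-order and mixed estimates for Lax curves *)

Section lax_curves.
Context {R : realType} (gamma : R) (j : nat) (U0 : 'rV[R]_4).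
Variable Phi : R -> 'rV[R]_4 -> 'rV[R]_4.
Hypothesis Phi_lax : lax_curve gamma j U0 Phi.

Let Phip (x : R * 'rV[R]_4) := Phi x.1 x.2.

Lemma lax_curve0 : exists2 r : R, 0 < r &
  forall U, `|U - U0| < r -> Phi 0 U = U.
Proof.
by have [a [r [_ r0 _ H]]] := Phi_lax; exists r => // U /H[].
Qed.

Lemma lax_box : exists A : set (R * 'rV[R]_4),
  C2_on A Phip /\ \forall x \near (0, U0), A x.
Proof.
have [a [r [a0 r0 C2 _]]] := Phi_lax; exists [set x | `|x.1| < a /\ `|x.2 - U0| < r]; split=> //.
apply/nbhs_normP; exists (Num.min a r); first by rewrite /= lt_min a0.
move=> [b U]; rewrite /ball_ /= prod_normE gt_max /= !lt_min sub0r normrN distrC.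
by move=> /andP[/andP[-> _] /andP[_ ->]].
Qed.

(** The strength direction is prescribed by [lax_curve]. In the state direction [Phi 0] is the
    identity near [U0], so the difference quotient is constant close to 0. *)
Lemma lax_derive b X :
  'D_(b, X) Phip (0, U0) = b *: eigvec gamma j U0 + X.
Proof.
have [A [[C1 _] nA]] := lax_box.
have [df _] := C1 _ (nbhs_singleton nA).
have [r r0 PhiI] := lax_curve0.
have -> : (b, X) = b *: ((1, 0) : R * 'rV[R]_4) + (0, X).
  by congr (_, _); rewrite /= ?scaler0 ?add0r ?addr0 // [_ *: _]mulr1.
rewrite deriveE // linearD linearZ /= -!deriveE //; congr (_ *: _ + _).
  have [a [r' [_ r0' _ /(_ U0)]]] := Phi_lax.
  rewrite subrr normr0 => /(_ r0')[_ [_ <-] _ _ _].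
  have E : (fun h : R => h^-1 *: ((Phip \o shift (0, U0)) (h *: (1, 0)) -
      Phip (0, U0))) =
    (fun h : R => h^-1 *: (((fun alpha => Phi alpha U0) \o shift 0) (h *: 1) -
      Phi 0 U0)).
    by apply/funext => h /=; rewrite /Phip /= scaler0 add0r.
  by rewrite /derive E.
rewrite /derive; apply: cvg_lim => //; apply: cvg_near_cst.
have : \forall h \near 0^', h != 0 :> R /\ `|h *: X| < r.
  pose X1 := `|X| + 1.
  have X10 : 0 < X1 by rewrite ltr_wpDl.
  exists (r / X1) => /=; first by rewrite divr_gt0.
  move=> h /=; rewrite sub0r normrN => hr h0; split=> //.
  rewrite normrZ (le_lt_trans (y := `|h| * X1)) //.
    by rewrite ler_wpM2l // lerDl.
  by rewrite -ltr_pdivlMr.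
apply: filterS => h [h0 hX] /=.
rewrite /Phip /= scaler0 addr0 !PhiI ?subrr ?normr0 // ?addrK //.
by rewrite scalerA mulVf // scale1r.
Qed.

Lemma lax_continuous : Phip x @[x --> (0, U0)] --> U0.
Proof.
have [A [[C1 _] nA]] := lax_box; have [r r0 PhiI] := lax_curve0.
have [/differentiable_continuous H _] := C1 _ (nbhs_singleton nA).
have {}H : Phip x @[x --> (0, U0)] --> Phi 0 U0 := H.
by rewrite PhiI ?subrr ?normr0 in H.
Qed.

Lemma lax_strict (e : R) : 0 < e -> exists2 r : R, 0 < r &
  forall b b' X Y, `|b| < r -> `|b'| < r -> `|X - U0| < r -> `|Y - U0| < r ->
  `|Phi b X - Phi b' Y - ((b - b') *: eigvec gamma j U0 + (X - Y))| <=
    e * Num.max `|b - b'| `|X - Y|.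
Proof.
move=> e0; have [A [[C1 _] nA]] := lax_box.
have [r r0 H] := C1_strict C1 nA e0; exists r => // b b' X Y br b'r Xr Yr.
have := H (b, X) (b', Y); rewrite lax_derive !prod_normE /= !subr0 !gt_max.
by rewrite br b'r Xr Yr; exact.
Qed.

(* Mean value theorem in [b] applied to [Phi b X - Phi b Y], whose derivative
   is Lipschitz in the state because [Phi] is C^2. *)
Lemma lax_mixed : exists C r : R, [/\ 0 < C, 0 < r &
  forall b X Y, `|b| < r -> `|X - U0| < r -> `|Y - U0| < r ->
  `|(Phi b X - X) - (Phi b Y - Y)| <= C * `|b| * `|X - Y|].
Proof.
have [A [[C1 C2] nA]] := lax_box.
have [r1 r10 PhiI] := lax_curve0.
have [C [r2 [C0 r20 H]]] := C1_lipschitz (C2 (1, 0)) nA.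
have [r3 r30 dA] := near_ball nA.
pose r := Num.min r1 (Num.min r2 r3).
exists C, r; split=> //; first by rewrite !lt_min r10 r20 r30.
move=> b X Y; rewrite !lt_min.
move=> /and3P[b1 b2 b3] /and3P[X1 X2 X3] /and3P[Y1 Y2 Y3].
pose g (t : R) := Phip (t, X) - Phip (t, Y).
have dPhi (Z : 'rV[R]_4) (t : R) : `|t| < r3 -> `|Z - U0| < r3 ->
    is_derive t b (fun t => Phip (t, Z)) (b *: 'D_(1, 0) Phip (t, Z)).
  move=> tr Zr.
  have [|df _] := C1 (t, Z).
    by apply: dA; rewrite prod_normE /= subr0 gt_max tr Zr.
  have -> : b *: 'D_(1, 0) Phip (t, Z) = 'D_(b, 0) Phip (t, Z).
    rewrite !deriveE // -linearZ; congr ('d _ _ (_, _)) => /=.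
      by rewrite [_ *: _]mulr1.
    by rewrite scaler0.
  have E : (fun h : R => h^-1 *: (((fun t : R => Phip (t, Z)) \o shift t) (h *: b)
      - Phip (t, Z))) =
    (fun h : R => h^-1 *: ((Phip \o shift (t, Z)) (h *: (b, 0)) - Phip (t, Z))).
    by apply/funext => h /=; rewrite /Phip /= scaler0 add0r.
  have := diff_derivable (v := (b, 0)) df; rewrite /derivable -E => d.
  by split; [|rewrite /derive E].
have tb (t : R) : 0 <= t <= 1 -> `|t * b| <= `|b|.
  by move=> /andP[t0 t1]; rewrite normrM (ger0_norm t0) ler_piMl.
have dg (t : R) : 0 <= t <= 1 ->
    is_derive (0 + t *: (b - 0)) (b - 0) g
      (b *: ('D_(1, 0) Phip (t * b, X) - 'D_(1, 0) Phip (t * b, Y))).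
  move=> /tb tb1; rewrite add0r subr0 scalerBr.
  by apply: is_deriveB; apply: dPhi => //; apply: le_lt_trans tb1 _.
have E : Phi b X - X - (Phi b Y - Y) = g b - g 0.
  by rewrite /g /Phip /= !PhiI // !opprB [LHS]addrACA [RHS]addrACA [- X - _]addrC.
rewrite E; apply: row_norm_le => [|i]; first by rewrite !mulr_ge0 // ltW.
have [t /dg|t t01] := @mvt_line _ R^o 4 g b 0 i.
  by case.
rewrite (_ : g b 0 i - g 0 0 i = (g b - g 0) 0 i); last by rewrite !mxE.
have [_ ->] := dg t t01; move=> ->; apply: le_trans (coord_le_norm _ _) _.
rewrite normrZ mulrAC [leRHS]mulrC ler_wpM2l //.
have tbr2 : `|t * b| < r2 := le_lt_trans (tb t t01) b2.
have := H (t * b, X) (t * b, Y).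
rewrite !prod_normE /= !subr0 !gt_max tbr2 X2 Y2 subrr normr0.
by rewrite (max_r (normr_ge0 _)); exact.
Qed.

End lax_curves.

(** * The characteristic fields at a state with v = 0 *)

Section characteristic_fields.
Context {R : realType}.

Lemma derive_line (X Y : normedModType R) (f : X -> Y) a v d :
  is_derive (0 : R) 1 (fun h : R => f (a + h *: v)) d -> 'D_v f a = d.
Proof.
move=> [_ <-].
have E : (fun h : R => h^-1 *: ((f \o shift a) (h *: v) - f a)) =
    (fun h : R => h^-1 *: (((fun h : R => f (a + h *: v)) \o shift 0) (h *: 1)
      - f (a + (0 : R) *: v))).
  by apply/funext => h /=; rewrite scale0r !addr0 [h *: 1]mulr1 [h *: v + a]addrC.
by rewrite /derive E.
Qed.

Lemma vec4E a b c d : [/\ velx (vec4 a b c d) = a :> R, vely (vec4 a b c d) = b,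
  pres (vec4 a b c d) = c & dens (vec4 a b c d) = d].
Proof. by rewrite /velx /vely /pres /dens !mxE !inordK. Qed.

Lemma velx_vec4 a b c d : velx (vec4 a b c d) = a :> R.
Proof. by case: (vec4E a b c d). Qed.
Lemma vely_vec4 a b c d : vely (vec4 a b c d) = b :> R.
Proof. by case: (vec4E a b c d). Qed.
Lemma pres_vec4 a b c d : pres (vec4 a b c d) = c :> R.
Proof. by case: (vec4E a b c d). Qed.
Lemma dens_vec4 a b c d : dens (vec4 a b c d) = d :> R.
Proof. by case: (vec4E a b c d). Qed.

Definition vec4K := (velx_vec4, vely_vec4, pres_vec4, dens_vec4).

Lemma stateE (U : 'rV[R]_4) : U = vec4 (velx U) (vely U) (pres U) (dens U).
Proof.
apply/rowP => i; rewrite mxE /velx /vely /pres /dens.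
have E k (k4 : (k < 4)%N) : inord k = Ordinal k4 :> 'I_4.
  by apply/val_inj; rewrite /= inordK.
by case: i => [[|[|[|[|//]]]] i4] /=; rewrite E.
Qed.

(** The scalar curves [u], [v], [c] stand for the velocities and the sound speed along a line of
    states, so one computation yields all four partial derivatives of [lambda]. Since [v 0 = 0], the
    root contributes no term in [dv]. *)
Lemma is_derive_characteristic (eps : R) (u v c : R -> R) (du dv dc : R) :
  0 < c 0 -> c 0 < u 0 -> v 0 = 0 ->
  is_derive (0 : R) (1 : R) u du -> is_derive (0 : R) (1 : R) v dv -> is_derive (0 : R) (1 : R) c dc ->
  let q := Num.sqrt (u 0 ^+ 2 - c 0 ^+ 2) in
  is_derive (0 : R) (1 : R) (fun h => (u h * v h
      + eps * c h * Num.sqrt (u h ^+ 2 + v h ^+ 2 - c h ^+ 2))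
      / (u h ^+ 2 - c h ^+ 2))
    (u 0 * dv / q ^+ 2
      + eps * (dc / q - c 0 * (u 0 * du - c 0 * dc) / q ^+ 3)).
Proof.
move=> c0 cu v0 hu hv hc q.
have Q0 : 0 < u 0 ^+ 2 - c 0 ^+ 2 by nra.
have q0 : 0 < q by rewrite sqrtr_gt0.
have qq : q ^+ 2 = u 0 ^+ 2 - c 0 ^+ 2 by rewrite sqr_sqrtr // ltW.
pose w h := u h ^+ 2 + v h ^+ 2 - c h ^+ 2.
have w0 : w 0 = u 0 ^+ 2 - c 0 ^+ 2 by rewrite /w v0; ring.
have hw : is_derive (0 : R) (1 : R) w (2 * u 0 * du - 2 * c 0 * dc).
  apply: is_derive_eq; rewrite v0 /GRing.scale /=; ring.
have hs : is_derive (0 : R) (1 : R) (fun h => Num.sqrt (w h))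
    ((2 * Num.sqrt (w 0))^-1 * (2 * u 0 * du - 2 * c 0 * dc)).
  apply: (is_derive1_comp (f := Num.sqrt)); apply: is_derive1_sqrt.
  by rewrite w0.
have hQ : is_derive (0 : R) (1 : R) (fun h => (u h ^+ 2 - c h ^+ 2)^-1)
  (- (u 0 ^+ 2 - c 0 ^+ 2) ^- 2 *: (2 * u 0 * du - 2 * c 0 * dc)).
  apply: is_deriveV; first by rewrite gt_eqF.
  by apply: is_derive_eq; rewrite /GRing.scale /=; ring.
apply: is_derive_eq.
rewrite -/(w 0) w0 -/q v0 -qq /GRing.scale /=.
field; rewrite gt_eqF //.
Qed.


Lemma sum4E (V : nmodType) (F : 'I_4 -> V) : \sum_i F i =
  F (inord 0) + F (inord 1) + F (inord 2) + F (inord 3).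
Proof.
rewrite !big_ord_recr big_ord0 /= add0r.
by do ![congr (_ + _)|congr F; apply/val_inj; rewrite /= inordK].
Qed.

Lemma state_delta (U : 'rV[R]_4) h k : (k < 4)%N ->
  let V := U + h *: delta_mx 0 (inord k) in
  [/\ velx V = velx U + h * (k == 0)%:R, vely V = vely U + h * (k == 1)%:R,
      pres V = pres U + h * (k == 2)%:R & dens V = dens U + h * (k == 3)%:R].
Proof.
move=> k4 V; have E i : (i < 4)%N -> V 0 (inord i) = U 0 (inord i) + h * (k == i)%:R.
  by move=> i4; rewrite !mxE eqxx /= -val_eqE /= !inordK // eq_sym.
by split; rewrite /velx /vely /pres /dens E.
Qed.

Lemma sound_gt0 (gamma : R) U : 0 < gamma -> 0 < pres U -> 0 < dens U ->
  0 < sound gamma U /\ sound gamma U ^+ 2 = gamma * pres U / dens U.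
Proof.
move=> g0 p0 r0; have c20 : 0 < gamma * pres U / dens U.
  by rewrite divr_gt0 // mulr_gt0.
by rewrite sqrtr_gt0 sqr_sqrtr // ltW.
Qed.

Section kappa.
Variables (gamma : R) (j : nat) (U : 'rV[R]_4).
Hypotheses (gamma1 : 1 < gamma) (supU : supersonic gamma U) (v0 : vely U = 0).

Let u := velx U.
Let p := pres U.
Let r := dens U.
Let c := sound gamma U.
Let q := Num.sqrt (u ^+ 2 - c ^+ 2).
Let eps : R := (-1) ^+ j.

Let p0 : 0 < p. Proof. by case: supU. Qed.
Let r0 : 0 < r. Proof. by case: supU. Qed.
Let cu : c < u. Proof. by case: supU. Qed.
Let g0 : 0 < gamma. Proof. exact: lt_trans gamma1. Qed.
Let c0 : 0 < c. Proof. by have [] := sound_gt0 g0 p0 r0. Qed.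
Let cc : c ^+ 2 = gamma * p / r. Proof. by have [] := sound_gt0 g0 p0 r0. Qed.
Let u0 : 0 < u. Proof. exact: lt_trans cu. Qed.
Let Q0 : 0 < u ^+ 2 - c ^+ 2. Proof. by have := c0; have := cu; nra. Qed.
Let q0 : 0 < q. Proof. by rewrite sqrtr_gt0. Qed.
Let qq : q ^+ 2 = u ^+ 2 - c ^+ 2. Proof. by rewrite sqr_sqrtr // ltW. Qed.

Lemma lambda_axis : lambda gamma j U = eps * c / q.
Proof.
rewrite /lambda v0 -/u -/c -/eps expr0n addr0 -/q -qq.
by field; rewrite gt_eqF.
Qed.

Let lambda_delta k (uk vk ck : R -> R) du dv dc :
  uk 0 = u -> vk 0 = 0 -> ck 0 = c ->
  (forall h, let V := U + h *: delta_mx 0 (inord k) in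
     [/\ velx V = uk h, vely V = vk h & sound gamma V = ck h]) ->
  is_derive (0 : R) (1 : R) uk du -> is_derive (0 : R) (1 : R) vk dv ->
  is_derive (0 : R) (1 : R) ck dc ->
  'D_(delta_mx 0 (inord k)) (lambda gamma j) U =
    u * dv / q ^+ 2 + eps * (dc / q - c * (u * du - c * dc) / q ^+ 3).
Proof.
move=> uk0 vk0 ck0 E du' dv' dc'.
apply: derive_line.
have := @is_derive_characteristic eps uk vk ck du dv dc.
rewrite uk0 vk0 ck0 -/q => /(_ c0 cu erefl du' dv' dc').
rewrite (_ : (fun h => _) =
  (fun h => lambda gamma j (U + h *: delta_mx 0 (inord k)))) //.
by apply/funext => h; have [] := E h; rewrite /lambda => -> -> ->.
Qed.

(** Every product in the sum defining [kappa] contains the sign [eps] twice or not at all, so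
    [eps * eps = 1] removes the dependence on [j]. The partial derivatives in pressure and density
    act through the sound speed only. *)
Lemma kappa_axis : kappa gamma j U =
  2 * (u ^+ 2 - c ^+ 2) ^+ 2 / ((gamma + 1) * u ^+ 3).
Proof.
have is_derive_id1 (a : R) : is_derive (0 : R) (1 : R) (fun h : R => a + h) 1.
  have := is_deriveD (is_derive_cst a (0 : R) (1 : R))
    (is_derive_id (0 : R) (1 : R)).
  by rewrite add0r.
have Du : 'D_(delta_mx 0 (inord 0)) (lambda gamma j) U = - eps * c * u / q ^+ 3.
  rewrite (@lambda_delta 0 (fun h => u + h) (fun=> 0) (fun=> c) 1 0 0) ?addr0 //.
    by field; rewrite gt_eqF.
  move=> h; have [//|a b d e] := state_delta U h (k := 0).
  by cbv zeta; rewrite /sound a b d e /= !mulr0 !addr0 ?mulr1 ?v0 ?add0r.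
have Dv : 'D_(delta_mx 0 (inord 1)) (lambda gamma j) U = u / q ^+ 2.
  rewrite (@lambda_delta 1 (fun=> u) (fun h => 0 + h) (fun=> c) 0 1 0) ?addr0 //.
    by field; rewrite gt_eqF.
  move=> h; have [//|a b d e] := state_delta U h (k := 1).
  by cbv zeta; rewrite /sound a b d e /= !mulr0 !addr0 ?mulr1 ?v0 ?add0r.
have Dp : 'D_(delta_mx 0 (inord 2)) (lambda gamma j) U =
    eps * u ^+ 2 / q ^+ 3 * (gamma / r / (2 * c)).
  have h1 : is_derive (0 : R) (1 : R) (fun h => gamma * (p + h) / r) (gamma / r).
    by apply: is_derive_eq; rewrite /GRing.scale /=; ring.
  have h2 : is_derive (0 : R) (1 : R) (fun h => Num.sqrt (gamma * (p + h) / r))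
      ((2 * Num.sqrt (gamma * (p + 0) / r))^-1 * (gamma / r)).
    apply: (is_derive1_comp (f := Num.sqrt)); apply: is_derive1_sqrt.
    by rewrite addr0 -cc exprn_gt0.
  have h3 : is_derive (0 : R) (1 : R) (fun h => Num.sqrt (gamma * (p + h) / r))
      (gamma / r / (2 * c)).
    by apply: is_derive_eq; rewrite addr0 -[Num.sqrt _]/c; field; rewrite !gt_eqF.
  rewrite (@lambda_delta 2 (fun=> u) (fun=> 0)
    (fun h => Num.sqrt (gamma * (p + h) / r)) 0 0 (gamma / r / (2 * c))) ?addr0 //.
    have -> : u ^+ 2 = q ^+ 2 + c ^+ 2 by rewrite qq; ring.
    by field; rewrite !gt_eqF.
  move=> h; have [//|a b d e] := state_delta U h (k := 2).
  by cbv zeta; rewrite /sound a b d e /= !mulr0 !addr0 mulr1 v0.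
have Dr : 'D_(delta_mx 0 (inord 3)) (lambda gamma j) U =
    eps * u ^+ 2 / q ^+ 3 * (- c / (2 * r)).
  have h0 : is_derive (0 : R) (1 : R) (fun h => (r + h)^-1) (- (r + 0) ^- 2 *: 1).
    by apply: (is_deriveV (f := fun h => r + h)); rewrite addr0 gt_eqF.
  have h1 : is_derive (0 : R) (1 : R) (fun h => gamma * p / (r + h))
      (- gamma * p / r ^+ 2).
    apply: is_derive_eq; rewrite /GRing.scale /= addr0; field.
    by rewrite gt_eqF.
  have h2 : is_derive (0 : R) (1 : R) (fun h => Num.sqrt (gamma * p / (r + h)))
      ((2 * Num.sqrt (gamma * p / (r + 0)))^-1 * (- gamma * p / r ^+ 2)).
    apply: (is_derive1_comp (f := Num.sqrt)); apply: is_derive1_sqrt.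
    by rewrite addr0 -cc exprn_gt0.
  have h3 : is_derive (0 : R) (1 : R) (fun h => Num.sqrt (gamma * p / (r + h)))
      (- c / (2 * r)).
    apply: is_derive_eq; rewrite addr0 -[Num.sqrt _]/c.
    have -> : - gamma * p / r ^+ 2 = - c ^+ 2 / r.
      by rewrite cc; field; rewrite gt_eqF.
    by field; rewrite !gt_eqF.
  rewrite (@lambda_delta 3 (fun=> u) (fun=> 0)
    (fun h => Num.sqrt (gamma * p / (r + h))) 0 0 (- c / (2 * r))) ?addr0 //.
    have -> : u ^+ 2 = q ^+ 2 + c ^+ 2 by rewrite qq; ring.
    by field; rewrite !gt_eqF.
  move=> h; have [//|a b d e] := state_delta U h (k := 3).
  by cbv zeta; rewrite /sound a b d e /= !mulr0 !addr0 mulr1 v0.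
rewrite /kappa sum4E Du Dv Dp Dr.
rewrite -/(velx (dir _ _ _)) -/(vely (dir _ _ _)) -/(pres (dir _ _ _)).
rewrite -/(dens (dir _ _ _)) /dir.
have [-> -> -> ->] := vec4E (- lambda gamma j U) 1
  (r * (lambda gamma j U * u - vely U)) (r * (lambda gamma j U * u - vely U) / c ^+ 2).
rewrite lambda_axis v0 subr0.
have e2 : eps * eps = 1 by rewrite /eps -expr2 sqrr_sign.
rewrite -qq -[RHS]invrK; congr (_^-1).
have ug : u ^+ 2 = q ^+ 2 + c ^+ 2 by rewrite qq; ring.
transitivity ((gamma + 1) * u ^+ 3 / (2 * (q ^+ 2) ^+ 2)); last first.
  by field; rewrite !gt_eqF // addr_gt0.
transitivity ((eps * eps) * (c ^+ 2 * u / q ^+ 4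
    + u ^+ 3 * (gamma - 1) / (2 * q ^+ 4)) + u * q ^+ 2 / q ^+ 4).
  by field; rewrite !gt_eqF.
rewrite e2; transitivity (u * (q ^+ 2 + c ^+ 2) / q ^+ 4
    + u ^+ 3 * (gamma - 1) / (2 * q ^+ 4)); first by field; rewrite gt_eqF.
by rewrite -ug; field; rewrite gt_eqF.
Qed.

End kappa.

End characteristic_fields.

(** * The strong shock *)

Section strong_shock_algebra.
Context {R : realType}.
Variables (g u p r c2 l ua va pa ra s : R).
Hypotheses (g1 : 1 < g) (u0 : 0 < u) (p0 : 0 < p) (r0 : 0 < r).
Hypotheses (c2E : c2 = g * p / r) (c2u : c2 < u ^+ 2).
Hypotheses (l0 : 0 < l) (lE : l ^+ 2 * (u ^+ 2 - c2) = c2).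
Hypotheses (ua0 : 0 < ua) (pa0 : 0 < pa) (ra0 : 0 < ra) (sva : va / ua < s).

(** [J1], ..., [J4] are the entries of W(U_m2) - W(U_a), the derivative of the residual in the shock
    speed; [b] is the enthalpy of U_m2. *)
Let k := g / (g - 1).
Let b := c2 / (g - 1).
Let J1 := r * u - ra * ua.
Let J2 := r * u ^+ 2 + p - (ra * ua ^+ 2 + pa).
Let J3 := - (ra * ua * va).
Let J4 := k * p * u + r * u ^+ 3 / 2
  - (k * pa * ua + ra * ua * (ua ^+ 2 + va ^+ 2) / 2).

Hypotheses (RH1 : s * J1 = - (ra * va)) (RH2 : s * J2 = J3)
  (RH3 : s * J3 = p - (ra * va ^+ 2 + pa))
  (RH4 : s * J4 = - (k * pa * va + ra * va * (ua ^+ 2 + va ^+ 2) / 2)).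

(** The mass flux through the shock. It is positive by the entropy condition lambda_2(U_a) < s, and
    conservation of mass, [m = s * r * u], then gives [0 < s]. *)
Let m := ra * (s * ua - va).

Let m0 : 0 < m.
Proof. by rewrite mulr_gt0 // subr_gt0 -ltr_pdivrMr. Qed.

Let mE : m = s * r * u.
Proof. by rewrite /m; move: RH1; rewrite /J1; lra. Qed.

Let s0 : 0 < s.
Proof.
have : 0 < s * (r * u) by rewrite mulrA -mE.
by rewrite pmulr_lgt0 // mulr_gt0.
Qed.

(** Conservation of the tangential velocity u + s v: a combination of the mass and momentum
    balances, divided by [m]. *)
Let uaE : ua = u - s * va.
Proof.
apply: (mulfI (lt0r_neq0 m0)).
have E : m * ua = s * (ra * ua ^+ 2) - ra * ua * va by rewrite /m; ring.
have E2 : m * (s * va) = - s * (s * J3 + ra * va ^+ 2) by rewrite /m /J3; ring.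
rewrite E mulrBr E2 RH3 mE.
by move: RH2; rewrite /J2 /J3; lra.
Qed.

Let paE : pa = p + va * m.
Proof. by rewrite /m; move: RH3; rewrite /J3; lra. Qed.

(** Serves to exclude [va = 0], since equal states violate the strict entropy inequalities. Without
    deflection the tangential relation fixes the velocity, and the mass flux then fixes the
    density. *)
Lemma strong_shock_nontrivial : va = 0 -> [/\ ua = u, pa = p & ra = r].
Proof.
move=> va0; move: uaE paE; rewrite va0 mulr0 subr0 mul0r addr0 => uE ->.
split=> //; apply: (mulIf (lt0r_neq0 (mulr_gt0 s0 u0))).
by move: mE; rewrite /m va0 uE; lra.
Qed.

(* Conservation of the Bernoulli constant, divided by the mass flux. *)
Let J4E : J4 = (b + u ^+ 2 / 2) * J1.
Proof.
have g10 : g - 1 != 0 by rewrite gt_eqF // subr_gt0.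
have bE : b * r = k * p.
  by rewrite /b c2E /k; field; rewrite g10 gt_eqF.
pose Ba := k * pa / ra + (ua ^+ 2 + va ^+ 2) / 2.
have Ba_b : Ba = b + u ^+ 2 / 2.
  apply: (mulfI (lt0r_neq0 m0)); rewrite {2}mE.
  have -> : m * Ba = s * (k * pa * ua + ra * ua * (ua ^+ 2 + va ^+ 2) / 2)
      - (k * pa * va + ra * va * (ua ^+ 2 + va ^+ 2) / 2).
    by rewrite /m /Ba; field; rewrite gt_eqF.
  have -> : s * r * u * (b + u ^+ 2 / 2) = s * (b * r * u + r * u ^+ 3 / 2) by ring.
  by rewrite bE; move: RH4; rewrite /J4; lra.
have -> : J4 = b * r * u + r * u ^+ 3 / 2 - ra * ua * Ba.
  by rewrite /J4 bE /Ba; field; rewrite gt_eqF.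
by rewrite Ba_b /J1; ring.
Qed.

Let g0 : 0 < g. Proof. exact: lt_trans ltr01 g1. Qed.

Let c20 : 0 < c2. Proof. by rewrite c2E divr_gt0 // mulr_gt0. Qed.

(** The value on the jump of W, up to the factor [- (ra * va) / s], of the linear form [functional]
    introduced below. *)
Let G := b + (u ^+ 2 + b) * (s * va) / u.

(* Positivity of [pa] bounds [s * va] from below. *)
Let G0 : 0 < G.
Proof.
have g10 : 0 < g - 1 by rewrite subr_gt0.
have b0 : 0 < b by rewrite divr_gt0.
have sva_gt : - (p / (r * u)) < s * va.
  rewrite -mulNr ltr_pdivrMr ?mulr_gt0 //.
  by move: pa0; rewrite paE mE; lra.
have pE : p / (r * u) = c2 / (g * u).
  by rewrite c2E; field; rewrite !gt_eqF //.
have : (u ^+ 2 + b) * (- (c2 / (g * u))) < (u ^+ 2 + b) * (s * va).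
  by rewrite ltr_pM2l -?pE // addr_gt0 // exprn_gt0.
rewrite -(ltr_pM2r (_ : 0 < u^-1)) ?invr_gt0 // => H.
apply: lt_trans (_ : b + (u ^+ 2 + b) * - (c2 / (g * u)) / u < G); last first.
  by rewrite /G ltrD2l.
(* This lower bound for [G] is positive because the flow below the shock is supersonic. *)
have -> : b + (u ^+ 2 + b) * - (c2 / (g * u)) / u =
    c2 * (u ^+ 2 - c2) / (g * (g - 1) * u ^+ 2).
  by rewrite /b; field; rewrite !gt_eqF //.
by rewrite divr_gt0 ?mulr_gt0 ?subr_gt0 ?exprn_gt0 //.
Qed.

(** The combination of the mass, x-momentum and energy rows that annihilates the 2- and 3-waves. The
    y-momentum row contains neither of them, so two equations remain for the 1-wave and the shock
    speed. *)
Let functional y1 y2 y4 := y4 + y1 * (u ^+ 2 / 2 + b) - (u ^+ 2 + b) * y2 / u.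

Let JpE : functional J1 J2 J4 = - (ra * va) / s * G.
Proof.
have sn0 : s != 0 by rewrite gt_eqF.
have -> : J2 = J1 * ua.
  by apply: (mulfI sn0); rewrite RH2 mulrA RH1 /J3; ring.
have -> : J1 = - (ra * va) / s by rewrite -RH1 mulrC mulKf.
rewrite /functional J4E (_ : J1 = - (ra * va) / s); last first.
  by rewrite -RH1 mulrC mulKf.
by rewrite uaE /G; field; rewrite !gt_eqF.
Qed.

Variable kap : R.
Hypothesis kap0 : 0 < kap.

(** The switch [t] merges two uses of one system: [t = 1] is the equation defining K, [t = 0]
    describes the kernel of the differential. The quantities [du], ..., [dr] are the entries of the
    combined 1-, 2- and 3-waves minus [t] times r_4. *)
Lemma strong_shock_elimination t x1 x2 x3 x4 :
  let du := x1 * (kap * l) + x2 * u + t * (kap * l) in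
  let dv := x1 * kap - t * kap in
  let dp := - (x1 * (kap * (r * l * u))) - t * (kap * (r * l * u)) in
  let dr := - (x1 * (kap * (r * l * u / c2))) + x3 * r - t * (kap * (r * l * u / c2)) in
  va != 0 ->
  s * (r * du + u * dr) - r * dv + x4 * J1 = 0 ->
  s * (u ^+ 2 * dr + 2 * r * u * du + dp) - r * u * dv + x4 * J2 = 0 ->
  s * (r * u * dv) - dp + x4 * J3 = 0 ->
  s * (k * (p * du + u * dp) + u ^+ 3 / 2 * dr + 3 / 2 * r * u ^+ 2 * du)
    - (k * p + r * u ^+ 2 / 2) * dv + x4 * J4 = 0 ->
  (t = 1 -> `|x1| < 1) /\ (t = 0 -> [/\ x1 = 0, x2 = 0, x3 = 0 & x4 = 0]).
Proof.
move=> du dv dp dr va0 e1 e2 e3 e4.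
have g10 : 0 < g - 1 by rewrite subr_gt0.
have ll0 : 0 < 1 + l ^+ 2 by rewrite addr_gt0 // exprn_gt0.
(* Expressing [c2] and [p] through [l] leaves no relation between the variables, so that [field] can
   check the combined row. *)
have c2l : c2 = l ^+ 2 * u ^+ 2 / (1 + l ^+ 2).
  apply: (mulIf (lt0r_neq0 ll0)); rewrite divfK ?gt_eqF //.
  by move: lE; lra.
have pE : p = r * c2 / g by rewrite c2E; field; rewrite !gt_eqF.
pose X := (u ^+ 2 - c2) / ((g - 1) * u).
have X0 : 0 < X by rewrite divr_gt0 ?mulr_gt0 // subr_gt0.
have E3 : kap * r * u * (x1 * (s + l) - t * (s - l)) = x4 * (ra * ua * va).
  by move: e3; rewrite /dv /dp /J3; lra.
have Ep : kap * r * l * u * X * (x1 * (s + l) + t * (s - l)) =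
    - (x4 * (ra * va) / s * G).
  have -> : - (x4 * (ra * va) / s * G) = x4 * functional J1 J2 J4.
    by rewrite JpE; ring.
  rewrite /functional; apply/eqP; rewrite -subr_eq0; apply/eqP.
  set S1 := (X in X + x4 * J1 = 0) in e1.
  set S2 := (X in X + x4 * J2 = 0) in e2.
  set S4 := (X in X + x4 * J4 = 0) in e4.
  have e1' : x4 * J1 = - S1 by apply/eqP; rewrite -addr_eq0 addrC e1.
  have e2' : x4 * J2 = - S2 by apply/eqP; rewrite -addr_eq0 addrC e2.
  have e4' : x4 * J4 = - S4 by apply/eqP; rewrite -addr_eq0 addrC e4.
  transitivity (kap * r * l * u * X * (x1 * (s + l) + t * (s - l)) -
    (x4 * J4 + x4 * J1 * (u ^+ 2 / 2 + b) - (u ^+ 2 + b) * (x4 * J2) / u)).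
    by ring.
  rewrite e1' e2' e4' /S1 /S2 /S4 /X /b /du /dv /dp /dr /k pE c2l.
  by field; rewrite !gt_eqF.
pose A := G / s; pose B := l * X * ua.
have A0 : 0 < A by rewrite /A divr_gt0.
have B0 : 0 < B by rewrite mulr_gt0 // mulr_gt0.
(* [E3] times [G / s] plus [Ep] times [ua]: the terms in [x4] cancel. *)
have x1E : x1 * ((s + l) * (A + B)) = t * ((s - l) * (A - B)).
  have kru0 : kap * r * u != 0 by rewrite gt_eqF // !mulr_gt0.
  apply: (mulfI kru0).
  transitivity (G / s * (kap * r * u * (x1 * (s + l) - t * (s - l)))
    + ua * (kap * r * l * u * X * (x1 * (s + l) + t * (s - l)))
    + kap * r * u * (t * ((s - l) * (A - B)))); first by rewrite /A /B; ring.
  by rewrite E3 Ep; ring.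
have N0 : 0 < (s + l) * (A + B) by rewrite mulr_gt0 // addr_gt0.
split=> t0.
  (* Both sides expand into the same four positive products; on the left two of them change sign. *)
  rewrite -(ltr_pM2r N0) -{1}(gtr0_norm N0) -normrM x1E t0 !mul1r ltr_norml.
  have sB := mulr_gt0 s0 B0; have sA := mulr_gt0 s0 A0.
  have lA := mulr_gt0 l0 A0; have lB := mulr_gt0 l0 B0.
  by apply/andP; split; lra.
have x10 : x1 = 0 by apply: (mulIf (lt0r_neq0 N0)); rewrite x1E t0 !mul0r.
have x40 : x4 = 0.
  move: E3; rewrite x10 t0 !mul0r subr0 mulr0 => /esym/eqP.
  by rewrite !mulf_eq0 (gt_eqF ra0) (gt_eqF ua0) (negbTE va0) !orbF => /eqP.
have nz : s * r * u != 0 by rewrite gt_eqF // !mulr_gt0.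
have y1 : x2 + x3 = 0.
  apply: (mulfI nz); rewrite mulr0 -e1 /du /dv /dr x10 t0 x40; ring.
have y2 : x3 + 2 * x2 = 0.
  apply: (mulfI nz); apply: (mulfI (lt0r_neq0 u0)).
  by rewrite !mulr0 -e2 /du /dv /dr /dp x10 t0 x40; ring.
by split=> //; lra.
Qed.

End strong_shock_algebra.

(** * Increments of smooth expressions *)

Section increments.
Context {R : realType} {Z : Type} (F : set_system Z) {FF : Filter F}.
Variable n : Z -> R.

(* [f] and [g] are the values of one quantity at two neighbouring points, [d]
   the value of its differential at the base point on their difference. *)
Definition increment (f g d : Z -> R) (a : R) :=
  [/\ f @ F --> a, g @ F --> a,
      exists C : R, \forall z \near F, `|d z| <= C * n z
    & forall e : R, 0 < e -> \forall z \near F, `|f z - g z - d z| <= e * n z].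

Lemma incrementD f1 g1 d1 a1 f2 g2 d2 a2 :
  increment f1 g1 d1 a1 -> increment f2 g2 d2 a2 ->
  increment (fun z => f1 z + f2 z) (fun z => g1 z + g2 z)
    (fun z => d1 z + d2 z) (a1 + a2).
Proof.
move=> [fa1 ga1 [C1 dC1] H1] [fa2 ga2 [C2 dC2] H2]; split.
- exact: cvgD.
- exact: cvgD.
- exists (C1 + C2); near=> z; rewrite mulrDl.
  apply: le_trans (ler_normD _ _) _; apply: lerD; near: z; exact.
move=> e e0; have e20 : 0 < e / 2 by rewrite divr_gt0.
near=> z; have -> : f1 z + f2 z - (g1 z + g2 z) - (d1 z + d2 z) =
  (f1 z - g1 z - d1 z) + (f2 z - g2 z - d2 z) by ring.
rewrite (splitr e) mulrDl; apply: le_trans (ler_normD _ _) _.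
by apply: lerD; near: z; [exact: H1|exact: H2].
Unshelve. all: by end_near. Qed.

Lemma incrementN f g d a : increment f g d a ->
  increment (fun z => - f z) (fun z => - g z) (fun z => - d z) (- a).
Proof.
move=> [fa ga [C dC] H]; split; [exact: cvgN|exact: cvgN| |].
  by exists C; near=> z; rewrite normrN; near: z.
move=> e e0; near=> z.
have -> : - f z - - g z - - d z = - (f z - g z - d z) by ring.
by rewrite normrN; near: z; exact: H.
Unshelve. all: by end_near. Qed.

Lemma incrementM f1 g1 d1 a1 f2 g2 d2 a2 :
  increment f1 g1 d1 a1 -> increment f2 g2 d2 a2 ->
  increment (fun z => f1 z * f2 z) (fun z => g1 z * g2 z)
    (fun z => a1 * d2 z + d1 z * a2) (a1 * a2).
Proof.
move=> [fa1 ga1 [C1 dC1] H1] [fa2 ga2 [C2 dC2] H2]; split.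
- exact: cvgM.
- exact: cvgM.
- exists (`|a1| * C2 + C1 * `|a2|); near=> z; rewrite mulrDl -[`|a1| * _ * _]mulrA [C1 * _ * _]mulrAC.
  apply: le_trans (ler_normD _ _) _; rewrite !normrM; apply: lerD.
    by apply: ler_wpM2l => //; near: z.
  by apply: ler_wpM2r => //; near: z.
move=> e e0.
(* The sum of the bounds for the four cofactors in the splitting below, each of which is paired with
   a share [e / K]. *)
pose K := (`|a1| + 1) + `|C2| + (`|a2| + 1) + `|C1|.
have K0 : 0 < K.
  by rewrite /K -!addrA; do ![apply: ltr_wpDl => //]; do ![apply: ltr_pwDl => //].
have eK : 0 < e / K by rewrite divr_gt0.
near=> z.
have -> : f1 z * f2 z - g1 z * g2 z - (a1 * d2 z + d1 z * a2) =
  f1 z * (f2 z - g2 z - d2 z) + (f1 z - a1) * d2 z +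
  (f1 z - g1 z - d1 z) * g2 z + d1 z * (g2 z - a2) by ring.
have b1 : `|f1 z| <= `|a1| + 1.
  rewrite -lerBlDl; apply: le_trans (lerB_dist _ _) _; near: z.
  exact: cvgr_distC_le fa1 _ ltr01.
have b2 : `|g2 z| <= `|a2| + 1.
  rewrite -lerBlDl; apply: le_trans (lerB_dist _ _) _; near: z.
  exact: cvgr_distC_le ga2 _ ltr01.
have b3 : `|f1 z - a1| <= e / K by near: z; exact: cvgr_distC_le fa1 _ eK.
have b4 : `|g2 z - a2| <= e / K by near: z; exact: cvgr_distC_le ga2 _ eK.
have b5 : `|f1 z - g1 z - d1 z| <= e / K * n z by near: z; exact: H1.
have b6 : `|f2 z - g2 z - d2 z| <= e / K * n z by near: z; exact: H2.
have n0 : 0 <= n z.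
  by rewrite -(pmulr_rge0 _ eK); apply: le_trans b6.
have b7 : `|d1 z| <= `|C1| * n z.
  apply: (@le_trans _ _ (C1 * n z)); first by near: z.
  by rewrite ler_wpM2r // ler_norm.
have b8 : `|d2 z| <= `|C2| * n z.
  apply: (@le_trans _ _ (C2 * n z)); first by near: z.
  by rewrite ler_wpM2r // ler_norm.
have -> : e * n z = (`|a1| + 1) * (e / K * n z) + e / K * (`|C2| * n z) +
    e / K * n z * (`|a2| + 1) + `|C1| * n z * (e / K).
  transitivity (e / K * K * n z); first by rewrite divfK // gt_eqF.
  by move: (e / K) => t; rewrite /K; ring.
have M x y s t : `|x| <= s -> `|y| <= t -> `|x * y| <= s * t.
  by move=> xs yt; rewrite normrM ler_pM.
do 3![apply: le_trans (ler_normD _ _) _; apply: lerD; last exact: M].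
exact: M.
Unshelve. all: by end_near. Qed.

Lemma increment_cst f a : f @ F --> a -> (\forall z \near F, 0 <= n z) ->
  increment f f (fun=> 0) a.
Proof.
move=> fa n0; split=> //.
  by exists 0; near=> z; rewrite normr0 mul0r.
move=> e e0; near=> z.
by rewrite subrr subr0 normr0 mulr_ge0 ?(ltW e0) //; near: z.
Unshelve. all: by end_near. Qed.

Lemma increment_id f g a : f @ F --> a -> g @ F --> a ->
  (\forall z \near F, `|f z - g z| <= n z) ->
  increment f g (fun z => f z - g z) a.
Proof.
move=> fa ga H; split=> //.
  by exists 1; near=> z; rewrite mul1r; near: z.
move=> e e0; near=> z; rewrite subrr normr0 mulr_ge0 ?(ltW e0) //.
have : `|f z - g z| <= n z by near: z.
exact: le_trans.
Unshelve. all: by end_near. Qed.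

(** The hypothesis on [h] is strict differentiability at [a]; with [y = a] it also supplies the
    continuity behind the two limits. *)
Lemma increment_comp (h : R -> R) (h' : R) f g d a :
  (forall e : R, 0 < e -> exists2 r : R, 0 < r &
     forall x y, `|x - a| < r -> `|y - a| < r ->
     `|h x - h y - h' * (x - y)| <= e * `|x - y|) ->
  increment f g d a ->
  increment (fun z => h (f z)) (fun z => h (g z)) (fun z => h' * d z) (h a).
Proof.
move=> hs [fa ga [C dC] H].
have hc : {for a, continuous h}.
  apply/cvgrPdistC_le => e e0; have [r r0 hr] := hs 1 ltr01.
  have K0 : 0 < `|h'| + 1 by rewrite ltr_wpDl.
  near=> x; have {}hr : `|h x - h a - h' * (x - a)| <= 1 * `|x - a|.
    apply: hr; last by rewrite subrr normr0.
    by near: x; apply: cvgr_distC_lt => //; exact: cvg_id.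
  have : `|x - a| <= e / (`|h'| + 1).
    near: x; apply: cvgr_distC_le; first exact: cvg_id.
    by rewrite divr_gt0.
  rewrite ler_pdivlMr // mulrDr mulr1 => xe; apply: le_trans xe.
  rewrite -(subrK (h' * (x - a)) (h x - h a)).
  apply: le_trans (ler_normD _ _) _; rewrite addrC; apply: lerD.
    by rewrite normrM mulrC.
  by rewrite mul1r in hr.
split.
- exact: continuous_cvg hc fa.
- exact: continuous_cvg hc ga.
- exists (`|h'| * C); near=> z; rewrite normrM -mulrA ler_wpM2l //.
  by near: z.
move=> e e0.
pose K := `|C| + 1 + `|h'| + 1.
have K0 : 0 < K by rewrite ltr_wpDl // !addr_ge0.
have eK : 0 < e / K by rewrite divr_gt0.
have [r r0 hr] := hs _ eK.
pose e1 := Num.min (e / K) 1.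
have e10 : 0 < e1 by rewrite lt_min eK ltr01.
near=> z.
have b1 : `|f z - g z - d z| <= e1 * n z by near: z; exact: H.
have b2 : `|d z| <= C * n z by near: z.
have n0 : 0 <= n z.
  by rewrite -(pmulr_rge0 _ e10); apply: le_trans b1.
have b3 : `|d z| <= `|C| * n z.
  by apply: le_trans b2 _; rewrite ler_wpM2r // ler_norm.
have b4 : `|f z - g z| <= (`|C| + 1) * n z.
  rewrite -(subrK (d z) (f z - g z)) mulrDl addrC.
  apply: le_trans (ler_normD _ _) _; apply: lerD => //.
  apply: le_trans b1 _; rewrite ler_wpM2r //.
  by rewrite /e1 ge_min lexx orbT.
have b5 : `|h (f z) - h (g z) - h' * (f z - g z)| <= e / K * `|f z - g z|.
  by apply: hr; near: z; apply: cvgr_distC_lt.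
have -> : h (f z) - h (g z) - h' * d z = (h (f z) - h (g z) - h' * (f z - g z))
  + h' * (f z - g z - d z) by ring.
have -> : e * n z = e / K * ((`|C| + 1) * n z) + `|h'| * (e / K * n z) +
    e / K * n z.
  transitivity (e / K * K * n z); first by rewrite divfK // gt_eqF.
  by move: (e / K) => t; rewrite /K; ring.
apply: le_trans (ler_normD _ _) _.
rewrite -[leLHS]addr0; apply: lerD; last by rewrite mulr_ge0 // ltW.
apply: lerD; first by apply: le_trans b5 _; rewrite ler_wpM2l // ltW.
rewrite normrM ler_wpM2l //; apply: le_trans b1 _; rewrite ler_wpM2r //.
by rewrite /e1 ge_min lexx.
Unshelve. all: by end_near. Qed.

End increments.

Lemma expR_strict (R : realType) (e : R) : 0 < e -> exists2 r : R, 0 < r &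
  forall x y : R, `|x - 0| < r -> `|y - 0| < r ->
  `|expR x - expR y - 1 * (x - y)| <= e * `|x - y|.
Proof.
move=> e0.
have : \forall x \near (0 : R), `|expR x - 1| <= e.
  have := @continuous_expR R 0; rewrite /continuous_at expR0.
  by move=> /cvgr_distC_le; apply.
move=> /near_ball[r r0 H]; exists r => // x y; rewrite !subr0 mul1r => xr yr.
wlog : x y xr yr / y <= x => [wl|yx].
  have [yx|/ltW xy] := leP y x; first exact: wl.
  rewrite -[leLHS]normrN [`|x - y|]distrC.
  have -> : - (expR x - expR y - (x - y)) = expR y - expR x - (y - x) by ring.
  exact: wl.
have [|c] := @MVT_segment R expR expR y x yx (fun z _ => is_derive_expR z).
  by apply: continuous_subspaceT => z; exact: continuous_expR.
rewrite in_itv /= => /andP[yc cx] ->.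
rewrite -[X in _ - X]mul1r -mulrBl normrM ler_wpM2r //; apply: H.
rewrite subr0 ltr_norml; move: xr yr; rewrite !ltr_norml => /andP[? ?] /andP[? ?].
by apply/andP; split; lra.
Qed.

(** * The Rankine-Hugoniot relations in terms of one flux *)

Section rankine_hugoniot.
Context {R : realType}.

Lemma vec4B (a b c d a' b' c' d' : R) :
  vec4 a b c d - vec4 a' b' c' d' = vec4 (a - a') (b - b') (c - c') (d - d').
Proof. by apply/rowP => -[[|[|[|[|//]]]] ?]; rewrite !mxE. Qed.

Lemma vec4_inj (a b c d a' b' c' d' : R) :
  vec4 a b c d = vec4 a' b' c' d' -> [/\ a = a', b = b', c = c' & d = d'].
Proof.
move=> E; have [e1 e2 e3 e4] := vec4E a b c d.
have [f1 f2 f3 f4] := vec4E a' b' c' d'.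
by split; [rewrite -e1 E|rewrite -e2 E|rewrite -e3 E|rewrite -e4 E].
Qed.

Lemma vec4D (a b c d a' b' c' d' : R) :
  vec4 a b c d + vec4 a' b' c' d' = vec4 (a + a') (b + b') (c + c') (d + d').
Proof. by apply/rowP => -[[|[|[|[|//]]]] ?]; rewrite !mxE. Qed.

Lemma vec4Z (t a b c d : R) :
  t *: vec4 a b c d = vec4 (t * a) (t * b) (t * c) (t * d).
Proof. by apply/rowP => -[[|[|[|[|//]]]] ?]; rewrite !mxE. Qed.

Lemma vec4_norm_le (a b c d e : R) : `|a| <= e -> `|b| <= e -> `|c| <= e ->
  `|d| <= e -> `|vec4 a b c d| <= e.
Proof.
move=> ae be ce de; apply: row_norm_le; first exact: le_trans (normr_ge0 a) ae.
by case=> [[|[|[|[|//]]]] ?]; rewrite mxE.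
Qed.

Variable gamma : R.

(* s W(U) - H(U), made polynomial in the entries of U. *)
Definition shock_flux (s : R) (U : 'rV[R]_4) : 'rV[R]_4 :=
  let: (u, v, p, r) := (velx U, vely U, pres U, dens U) in
  let w := s * u - v in
  vec4 (r * w) (r * w * u + s * p) (r * w * v - p)
    (w * (gamma / (gamma - 1) * p + r * ((u * u + v * v) / 2))).

(** Written in the shape that the sum and product rules for [increment] produce, so that the first
    three entries match by conversion. *)
Definition shock_flux_diff (s : R) (U : 'rV[R]_4) (ds : R) (dU : 'rV[R]_4) :
    'rV[R]_4 :=
  let: (u, v, p, r) := (velx U, vely U, pres U, dens U) in
  let: (du, dv, dp, dr) := (velx dU, vely dU, pres dU, dens dU) in
  let w := s * u - v in
  let dw := s * du + ds * u - dv in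
  let k := gamma / (gamma - 1) in
  vec4 (r * dw + dr * w)
    (r * w * du + (r * dw + dr * w) * u + (s * dp + ds * p))
    (r * w * dv + (r * dw + dr * w) * v - dp)
    (w * (k * dp + (r * ((u * du + du * u + (v * dv + dv * v)) / 2)
       + dr * ((u * u + v * v) / 2)))
     + dw * (k * p + r * ((u * u + v * v) / 2))).

Lemma shock_fluxE s U : 1 < gamma -> dens U != 0 ->
  shock_flux s U = s *: Wflux gamma U - Hflux gamma U.
Proof.
move=> g1 r0; have g10 : gamma - 1 != 0 by rewrite subr_eq0 gt_eqF.
rewrite /shock_flux /Wflux /Hflux /enthalpy vec4Z vec4B.
by congr vec4; [ring|ring|ring|field; rewrite g10 r0].
Qed.

Lemma rankine_hugoniotP s U V : 1 < gamma -> dens U != 0 -> dens V != 0 ->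
  s *: (Wflux gamma V - Wflux gamma U) = Hflux gamma V - Hflux gamma U <->
  shock_flux s U = shock_flux s V.
Proof.
move=> g1 U0 V0; rewrite !shock_fluxE // scalerBr.
set a := s *: Wflux _ V; set b := s *: Wflux _ U.
set c := Hflux _ V; set d := Hflux _ U.
have E : b - d - (a - c) = - (a - b - (c - d)).
  rewrite !opprB [LHS]addrC [LHS]addrACA [RHS]addrACA; congr (_ + _).
  exact: addrC.
split=> /eqP; rewrite -subr_eq0 => /eqP e; apply/eqP; rewrite -subr_eq0.
  by rewrite E e oppr0.
by rewrite -oppr_eq0 -E e.
Qed.

Lemma shock_flux_strict s0 U0 (e : R) : 0 < e -> exists2 r : R, 0 < r &
  forall s s' X Y, `|s - s0| < r -> `|s' - s0| < r ->
    `|X - U0| < r -> `|Y - U0| < r ->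
  `|shock_flux s X - shock_flux s' Y - shock_flux_diff s0 U0 (s - s') (X - Y)|
    <= e * Num.max `|s - s'| `|X - Y|.
Proof.
move=> e0.
pose Z := ((R * 'rV[R]_4) * (R * 'rV[R]_4))%type.
(* Strict differentiability concerns two independent points near the base, that is, the
   neighbourhoods of a diagonal point of the product. *)
pose F : set_system Z := nbhs ((s0, U0), (s0, U0)).
have FF : Filter F by exact: nbhs_filter.
pose n (z : Z) := `|z.1 - z.2|.
have nE (z : Z) : n z = Num.max `|z.1.1 - z.2.1| `|z.1.2 - z.2.2|.
  by rewrite /n prod_normE.
have F1 : (fun z : Z => z.1) @ F --> (s0, U0) by exact: cvg_fst.
have F2 : (fun z : Z => z.2) @ F --> (s0, U0) by exact: cvg_snd.
have is_ : increment F n (fun z => z.1.1) (fun z => z.2.1)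
    (fun z => z.1.1 - z.2.1) s0.
  apply: increment_id.
  - exact: (cvg_comp _ _ F1 cvg_fst).
  - exact: (cvg_comp _ _ F2 cvg_fst).
  by near=> z; rewrite nE le_max lexx.
have iX i : increment F n (fun z => z.1.2 0 i) (fun z => z.2.2 0 i)
    (fun z => (z.1.2 - z.2.2) 0 i) (U0 0 i).
  rewrite (_ : (fun z : Z => (z.1.2 - z.2.2) 0 i) =
    fun z : Z => z.1.2 0 i - z.2.2 0 i); last first.
    by apply/funext => z; rewrite !mxE.
  apply: increment_id.
  - apply: (cvg_comp (fun z : Z => z.1.2) _ _ (@coord_continuous _ _ _ 0 i U0)).
    exact: (cvg_comp _ _ F1 cvg_snd).
  - apply: (cvg_comp (fun z : Z => z.2.2) _ _ (@coord_continuous _ _ _ 0 i U0)).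
    exact: (cvg_comp _ _ F2 cvg_snd).
  near=> z; rewrite nE le_max; apply/orP; right.
  rewrite (_ : _ - _ = (z.1.2 - z.2.2) 0 i) ?coord_le_norm //.
  by rewrite !mxE.
have ic (a : R) : increment F n (fun=> a) (fun=> a) (fun=> 0) a.
  by apply: increment_cst; [exact: cvg_cst|near=> z; exact: normr_ge0].
have iu := iX (inord 0); have iv := iX (inord 1).
have ip := iX (inord 2); have ir := iX (inord 3).
have iw := incrementD (FF := FF) (incrementM (FF := FF) is_ iu) (incrementN (FF := FF) iv).
have irw := incrementM (FF := FF) ir iw.
have i1 := irw.
have i2 := incrementD (FF := FF) (incrementM (FF := FF) irw iu)
  (incrementM (FF := FF) is_ ip).
have i3 := incrementD (FF := FF) (incrementM (FF := FF) irw iv)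
  (incrementN (FF := FF) ip).
have i4 := incrementM (FF := FF) iw (incrementD (FF := FF)
  (incrementM (FF := FF) (ic (gamma / (gamma - 1))) ip)
  (incrementM (FF := FF) ir (incrementM
     (incrementD (FF := FF) (incrementM (FF := FF) iu iu)
       (incrementM (FF := FF) iv iv)) (ic 2^-1)))).
case: i1 => _ _ _ /(_ e e0) H1; case: i2 => _ _ _ /(_ e e0) H2.
case: i3 => _ _ _ /(_ e e0) H3; case: i4 => _ _ _ /(_ e e0) H4.
have : \forall z \near F, `|shock_flux z.1.1 z.1.2 - shock_flux z.2.1 z.2.2 -
    shock_flux_diff s0 U0 (z.1.1 - z.2.1) (z.1.2 - z.2.2)| <= e * n z.
  apply: filterS (filterI (filterI H1 H2) (filterI H3 H4)).
  move=> z [[h1 h2] [h3 h4]].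
  rewrite /shock_flux /shock_flux_diff !vec4B; apply: vec4_norm_le.
  - exact: h1.
  - exact: h2.
  - exact: h3.
  apply: le_trans h4; rewrite le_eqVlt; apply/orP; left; apply/eqP.
  by congr `|_|; rewrite /velx /vely /pres /dens; ring.
move=> /near_ball[r r0 H]; exists r => // s s' X Y sr s'r Xr Yr.
have := H ((s, X), (s', Y)); rewrite nE /=; apply.
by rewrite !prod_normE /= !gt_max sr s'r Xr Yr.
Unshelve. all: by end_near. Qed.

End rankine_hugoniot.

(** * Composition of the 1-, 2- and 3-waves *)

Section wave_curves.
Context {R : realType} (gamma : R) (j : nat) (U0 qb : 'rV[R]_4).
Variable Phi : R -> 'rV[R]_4 -> 'rV[R]_4.
Hypothesis Phi_lax : lax_curve gamma j U0 Phi.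
Hypotheses (qb0 : velx qb = 0) (qb1 : vely qb = 0) (qb2 : pres qb = 0).

(* [q] packs (delta_1, delta_2, delta_3, sigma_4); the accessors of states
   serve as the coordinate projections of that vector. *)
Definition wave_states (q U : 'rV[R]_4) : 'rV[R]_4 :=
  Phi3 (pres q) (Phi2 (vely q) (Phi (velx q) U)).

Definition wave_states_diff (dq : 'rV[R]_4) : 'rV[R]_4 :=
  velx dq *: eigvec gamma j U0 +
  vec4 (vely dq * velx U0) (vely dq * vely U0) 0 (pres dq * dens U0).

(** The third component is a state moving freely near [U0], while [n] measures the difference of the
    parameters only; the estimates are thus uniform in the state. *)
Let Z := ('rV[R]_4 * 'rV[R]_4 * 'rV[R]_4)%type.
Let F : set_system Z := nbhs ((qb, qb), U0).
Let n (z : Z) := `|z.1.1 - z.1.2|.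

Let FF : Filter F. Proof. exact: nbhs_filter. Qed.

Let F1 : (fun z : Z => z.1.1) @ F --> qb.
Proof. exact: (cvg_comp _ _ cvg_fst cvg_fst). Qed.

Let F2 : (fun z : Z => z.1.2) @ F --> qb.
Proof. exact: (cvg_comp _ _ cvg_fst cvg_snd). Qed.

Let FU : (fun z : Z => z.2) @ F --> U0.
Proof. exact: cvg_snd. Qed.

Let iq i : increment F n (fun z => z.1.1 0 i) (fun z => z.1.2 0 i)
  (fun z => (z.1.1 - z.1.2) 0 i) (qb 0 i).
Proof.
rewrite (_ : (fun z : Z => (z.1.1 - z.1.2) 0 i) =
  fun z : Z => z.1.1 0 i - z.1.2 0 i); last first.
  by apply/funext => z; rewrite !mxE.
apply: increment_id.
- exact: (cvg_comp (fun z : Z => z.1.1) _ F1 (@coord_continuous _ _ _ 0 i qb)).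
- exact: (cvg_comp (fun z : Z => z.1.2) _ F2 (@coord_continuous _ _ _ 0 i qb)).
near=> z; rewrite (_ : _ - _ = (z.1.1 - z.1.2) 0 i) ?coord_le_norm //.
by rewrite !mxE.
Unshelve. all: by end_near. Qed.

Let iexp i : qb 0 i = 0 ->
  increment F n (fun z => expR (z.1.1 0 i)) (fun z => expR (z.1.2 0 i))
    (fun z => 1 * (z.1.1 - z.1.2) 0 i) 1.
Proof.
move=> qi; have I := iq i; rewrite qi in I.
by have := increment_comp (FF := FF) (@expR_strict R) I; rewrite expR0.
Qed.

Let cvgPhi (q : Z -> 'rV[R]_4) : q @ F --> qb ->
  Phi (velx (q z)) z.2 @[z --> F] --> U0.
Proof.
move=> qF.
have vF : velx (q z) @[z --> F] --> (0 : R).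
  by rewrite -qb0; exact: (cvg_comp q _ qF (@coord_continuous _ _ _ 0 (inord 0) qb)).
have P : (velx (q z), z.2) @[z --> F] --> ((0 : R), U0) by exact: (cvg_pair vF FU).
exact: (cvg_comp _ _ P (lax_continuous Phi_lax)).
Qed.

(** The eigenvector may be frozen at [U0] although the state moves, by [lax_strict] with the same
    state on both sides. *)
Let iPhi i : increment F n (fun z => Phi (velx z.1.1) z.2 0 i)
  (fun z => Phi (velx z.1.2) z.2 0 i)
  (fun z => velx (z.1.1 - z.1.2) * eigvec gamma j U0 0 i) (U0 0 i).
Proof.
split.
- exact: (cvg_comp _ _ (cvgPhi F1) (@coord_continuous _ _ _ 0 i U0)).
- exact: (cvg_comp _ _ (cvgPhi F2) (@coord_continuous _ _ _ 0 i U0)).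
- exists `|eigvec gamma j U0 0 i|; near=> z.
  by rewrite normrM mulrC ler_wpM2l // coord_le_norm.
move=> e e0; have [r r0 H] := lax_strict Phi_lax e0.
have V0 : \forall z \near F, `|z.2 - U0| < r.
  exact: (@cvgr_distC_lt _ _ _ F _ _ _ FU).
have V1 : \forall z \near F, `|velx z.1.1| < r.
  have [+ _ _ _] := iq (inord 0); rewrite -/(velx qb) qb0.
  by move=> /cvgr_distC_lt /(_ r r0); apply: filterS => z; rewrite subr0.
have V2 : \forall z \near F, `|velx z.1.2| < r.
  have [_ + _ _] := iq (inord 0); rewrite -/(velx qb) qb0.
  by move=> /cvgr_distC_lt /(_ r r0); apply: filterS => z; rewrite subr0.
near=> z.
have := H (velx z.1.1) (velx z.1.2) z.2 z.2.
rewrite subrr addr0 normr0 (max_l (normr_ge0 _)) => Hz.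
have vE : velx z.1.1 - velx z.1.2 = velx (z.1.1 - z.1.2) by rewrite /velx !mxE.
apply: (@le_trans _ _ (e * `|velx z.1.1 - velx z.1.2|)); last first.
  by rewrite ler_wpM2l ?(ltW e0) // vE coord_le_norm.
apply: le_trans (Hz _ _ _ _); [|by near: z..].
apply: le_trans (coord_le_norm _ i); rewrite !mxE vE.
by rewrite le_eqVlt eqxx.
Unshelve. all: by end_near. Qed.

Let i1 := incrementM (FF := FF) (iPhi (inord 0)) (iexp qb1).
Let i2 := incrementM (FF := FF) (iPhi (inord 1)) (iexp qb1).
Let i3 := iPhi (inord 2).
Let i4 := incrementM (FF := FF) (iPhi (inord 3)) (iexp qb2).

Lemma wave_statesE q U : wave_states q U =
  vec4 (velx (Phi (velx q) U) * expR (vely q))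
    (vely (Phi (velx q) U) * expR (vely q)) (pres (Phi (velx q) U))
    (dens (Phi (velx q) U) * expR (pres q)).
Proof.
rewrite /wave_states /Phi3 /Phi2.
by have [-> -> -> ->] := vec4E (velx (Phi (velx q) U) * expR (vely q))
    (vely (Phi (velx q) U) * expR (vely q)) (pres (Phi (velx q) U))
    (dens (Phi (velx q) U)).
Qed.

Lemma wave_states_strict (e : R) : 0 < e -> exists2 r : R, 0 < r &
  forall q q' U, `|q - qb| < r -> `|q' - qb| < r -> `|U - U0| < r ->
  `|wave_states q U - wave_states q' U - wave_states_diff (q - q')| <=
    e * `|q - q'|.
Proof.
move=> e0.
case: i1 => _ _ _ /(_ e e0) H1; case: i2 => _ _ _ /(_ e e0) H2.
case: i3 => _ _ _ /(_ e e0) H3; case: i4 => _ _ _ /(_ e e0) H4.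
have : \forall z \near F, `|wave_states z.1.1 z.2 - wave_states z.1.2 z.2 -
    wave_states_diff (z.1.1 - z.1.2)| <= e * n z.
  apply: filterS (filterI (filterI H1 H2) (filterI H3 H4)).
  move=> z [[h1 h2] [h3 h4]].
  rewrite !wave_statesE /wave_states_diff (stateE (eigvec _ _ _)).
  rewrite vec4Z vec4D !vec4B.
  apply: vec4_norm_le; [move: h1|move: h2|move: h3|move: h4];
    apply: le_trans; rewrite le_eqVlt; apply/orP; left; apply/eqP;
    by congr `|_|; rewrite /velx /vely /pres /dens; ring.
move=> /near_ball[r r0 H]; exists r => // q q' U qr q'r Ur.
by apply: (H ((q, q'), U)); rewrite !prod_normE /= !gt_max qr q'r Ur.
Qed.

Lemma wave_states_continuous (e : R) : 0 < e -> exists2 r : R, 0 < r &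
  forall q U, `|q - qb| < r -> `|U - U0| < r -> `|wave_states q U - U0| < e.
Proof.
move=> e0; have e20 : 0 < e / 2 by rewrite divr_gt0.
case: i1 => /cvgr_distC_le /(_ _ e20) H1 _ _ _.
case: i2 => /cvgr_distC_le /(_ _ e20) H2 _ _ _.
case: i3 => /cvgr_distC_le /(_ _ e20) H3 _ _ _.
case: i4 => /cvgr_distC_le /(_ _ e20) H4 _ _ _.
have : \forall z \near F, `|wave_states z.1.1 z.2 - U0| <= e / 2.
  apply: filterS (filterI (filterI H1 H2) (filterI H3 H4)).
  move=> z [[h1 h2] [h3 h4]].
  rewrite !wave_statesE (stateE U0) vec4B.
  by rewrite !mulr1 in h1 h2 h4; apply: vec4_norm_le.
move=> /near_ball[r r0 H]; exists r => // q U qr Ur.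
have := H ((q, q), U); rewrite !prod_normE /= !gt_max qr Ur => /(_ isT).
by move=> /le_lt_trans; apply; rewrite ltr_pdivrMr // mulr2n mulrDr mulr1 ltrDl.
Qed.

End wave_curves.

(** * The linearized problem at the background states *)

Section linearization.
Context {R : realType} (gamma : R) (Um Ua : 'rV[R]_4) (s0 : R).
Hypothesis gamma1 : 1 < gamma.
Hypotheses (Um_axis : vely Um = 0) (strong : shock gamma 4 s0 Um Ua).

(** The differential in [q] of the residual defined further on, with the outer states fixed at [Um]
    and [Ua]. The last coordinate, the speed, acts on both fluxes. *)
Definition strong_diff (q : 'rV[R]_4) : 'rV[R]_4 :=
  shock_flux_diff gamma s0 Um (dens q) (wave_states_diff gamma 1 Um q)
  - dens q *: shock_flux_diff gamma s0 Ua 1 0.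

Lemma state_linear (a : R) (x y : 'rV[R]_4) :
  [/\ velx (a *: x + y) = a * velx x + velx y,
      vely (a *: x + y) = a * vely x + vely y,
      pres (a *: x + y) = a * pres x + pres y
    & dens (a *: x + y) = a * dens x + dens y].
Proof. by rewrite /velx /vely /pres /dens !mxE. Qed.

Lemma wave_states_diff_linear j : linear (wave_states_diff gamma j Um).
Proof.
move=> a x y; rewrite /wave_states_diff (stateE (eigvec _ _ _)).
have [-> -> -> _] := state_linear a x y.
by rewrite !vec4Z !vec4D vec4Z vec4D; congr vec4; ring.
Qed.

Lemma shock_flux_diff_linear s U a ds1 dU1 ds2 dU2 :
  shock_flux_diff gamma s U (a * ds1 + ds2) (a *: dU1 + dU2) =
  a *: shock_flux_diff gamma s U ds1 dU1 + shock_flux_diff gamma s U ds2 dU2.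
Proof.
rewrite /shock_flux_diff; have [-> -> -> ->] := state_linear a dU1 dU2.
by rewrite !vec4Z !vec4D; congr vec4; ring.
Qed.

Lemma strong_diff_linear : linear strong_diff.
Proof.
move=> a x y; rewrite /strong_diff wave_states_diff_linear.
have [_ _ _ ->] := state_linear a x y.
rewrite shock_flux_diff_linear scalerDl -scalerA scalerBr opprD.
by rewrite addrACA.
Qed.

Let u := velx Um.
Let p := pres Um.
Let r := dens Um.
Let c := sound gamma Um.
Let l := lambda gamma 4 Um.
Let kap := kappa gamma 4 Um.

Lemma eigvec4_axis :
  eigvec gamma 4 Um = vec4 (- (kap * l)) kap (kap * (r * l * u))
    (kap * (r * l * u / c ^+ 2)).
Proof.
by rewrite /eigvec /dir Um_axis -/kap -/l -/u -/r -/c vec4Z subr0; congr vec4; ring.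
Qed.

Lemma eigvec1_axis :
  eigvec gamma 1 Um = vec4 (kap * l) kap (- (kap * (r * l * u)))
    (- (kap * (r * l * u / c ^+ 2))).
Proof.
have supUm : supersonic gamma Um by case: strong.
have l1 : lambda gamma 1 Um = - l.
  by rewrite /l !lambda_axis // expr1 -signr_odd /= expr0; ring.
have k1 : kappa gamma 1 Um = kap by rewrite /kap !kappa_axis.
by rewrite /eigvec /dir Um_axis k1 l1 -/u -/r -/c vec4Z subr0; congr vec4; ring.
Qed.

Lemma strong_diff_solve t q :
  strong_diff q = t *: shock_flux_diff gamma s0 Um 0 (eigvec gamma 4 Um) ->
  (t = 1 -> `|velx q| < 1) /\ (t = 0 -> q = 0).
Proof.
have [supUm supUa RH /andP[sU Us] [_ /(_ erefl) sV]] := strong.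
have [p0 r0 cu] := supUm; have [pa0 ra0 cua] := supUa.
have g0 : 0 < gamma := lt_trans ltr01 gamma1.
have [c0 cc] := sound_gt0 g0 p0 r0.
have [ca0 _] := sound_gt0 g0 pa0 ra0.
rewrite -/u -/c in cu; rewrite -/c in c0 cc; rewrite -/p -/r in cc p0 r0.
have u0 : 0 < u := lt_trans c0 cu.
have ua0 : 0 < velx Ua := lt_trans ca0 cua.
have cu2 : c ^+ 2 < u ^+ 2 by rewrite ltr_pXn2r // ?nnegrE ltW.
have Q0 : 0 < u ^+ 2 - c ^+ 2 by rewrite subr_gt0.
have lE : l = c / Num.sqrt (u ^+ 2 - c ^+ 2).
  by rewrite /l lambda_axis // -signr_odd /= expr0 mul1r.
have q0 : 0 < Num.sqrt (u ^+ 2 - c ^+ 2) by rewrite sqrtr_gt0.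
have l0 : 0 < l by rewrite lE divr_gt0.
have l2 : l ^+ 2 * (u ^+ 2 - c ^+ 2) = c ^+ 2.
  by rewrite -[X in _ * X](sqr_sqrtr (ltW Q0)) lE; field; rewrite gt_eqF.
have kap0 : 0 < kap.
  by rewrite /kap kappa_axis // divr_gt0 // ?mulr_gt0 ?exprn_gt0 // addr_gt0.
have {}RH : shock_flux gamma s0 Um = shock_flux gamma s0 Ua.
  by apply/rankine_hugoniotP => //; rewrite gt_eqF.
rewrite /shock_flux Um_axis -/u -/p -/r in RH.
set ua := velx Ua in RH ua0 cua; set va := vely Ua in RH.
set pa := pres Ua in RH pa0; set ra := dens Ua in RH ra0.
have [RH1 RH2 RH3 RH4] := vec4_inj RH.
have K1 : s0 * (r * u - ra * ua) = - (ra * va) by lra.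
have K2 : s0 * (r * u ^+ 2 + p - (ra * ua ^+ 2 + pa)) = - (ra * ua * va) by lra.
have K3 : s0 * - (ra * ua * va) = p - (ra * va ^+ 2 + pa) by lra.
have K4 : s0 * (gamma / (gamma - 1) * p * u + r * u ^+ 3 / 2 -
   (gamma / (gamma - 1) * pa * ua + ra * ua * (ua ^+ 2 + va ^+ 2) / 2)) =
  - (gamma / (gamma - 1) * pa * va + ra * va * (ua ^+ 2 + va ^+ 2) / 2).
  by move: RH4; set k := gamma / (gamma - 1); lra.
(* Here the shock has to be a genuine one: the Lax inequalities separate [Um] from [Ua]. With
   [va = 0] a change of speed would be invisible in the y-momentum row. *)
have va0 : va != 0.
  apply/eqP => va0.
  have [uE pE rE] := strong_shock_nontrivial u0 r0 ua0 ra0 sV K1 K2 K3 va0.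
  suff UE : Um = Ua by move: (lt_trans sU Us); rewrite UE ltxx.
  by rewrite (stateE Um) (stateE Ua) Um_axis -/ua -/va -/pa -/ra va0 uE pE rE.
move=> E.
have {}E : strong_diff q - t *: shock_flux_diff gamma s0 Um 0 (eigvec gamma 4 Um)
    = vec4 0 0 0 0.
  by rewrite E subrr; apply/rowP => -[[|[|[|[|//]]]] ?]; rewrite !mxE.
have z0 : [/\ velx (0 : 'rV[R]_4) = 0, vely (0 : 'rV[R]_4) = 0,
  pres (0 : 'rV[R]_4) = 0 & dens (0 : 'rV[R]_4) = 0].
  by rewrite /velx /vely /pres /dens !mxE.
rewrite /strong_diff /wave_states_diff eigvec1_axis eigvec4_axis in E.
rewrite !vec4Z !vec4D /shock_flux_diff !vec4K in E.
case: z0 => z1 z2 z3 z4; rewrite !z1 !z2 !z3 !z4 Um_axis in E.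
rewrite -/ua -/va -/pa -/ra -/u -/p -/r ?vec4Z !vec4B in E.
have {E} [E1 E2 E3 E4] := vec4_inj E.
have [|||||H1 H0] := @strong_shock_elimination R gamma u p r (c ^+ 2) l ua va pa ra s0
  gamma1 u0 p0 r0 cc cu2 l0 l2 ua0 pa0 ra0 sV K1 K2 K3 K4 kap kap0
  t (velx q) (vely q) (pres q) (dens q).
- exact: va0.
- by rewrite -E1; ring.
- by rewrite -E2; ring.
- by rewrite -E3; ring.
- by rewrite -E4; ring.
split=> // /H0[q1 q2 q3 q4]; rewrite (stateE q) q1 q2 q3 q4.
by apply/rowP => -[[|[|[|[|//]]]] ?]; rewrite !mxE.
Qed.

End linearization.

(** * Shock conditions and fixed points *)

Section shock_conditions.
Context {R : realType} (gamma : R).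
Hypothesis gamma1 : 1 < gamma.

Section limits.
Variables (U0 : 'rV[R]_4) (F : set_system 'rV[R]_4).
Context {FF : Filter F}.
Hypothesis FU : F --> U0.
Hypothesis sup : supersonic gamma U0.

Let cvg_entry i : (U : 'rV[R]_4) 0 i @[U --> F] --> U0 0 i.
Proof. exact: (cvg_comp id _ FU (@coord_continuous _ _ _ 0 i U0)). Qed.

Lemma velx_cvg : velx U @[U --> F] --> velx U0.
Proof. exact: cvg_entry. Qed.

Lemma vely_cvg : vely U @[U --> F] --> vely U0.
Proof. exact: cvg_entry. Qed.

Lemma pres_cvg : pres U @[U --> F] --> pres U0.
Proof. exact: cvg_entry. Qed.

Lemma dens_cvg : dens U @[U --> F] --> dens U0.
Proof. exact: cvg_entry. Qed.

Lemma sound_cvg : sound gamma U @[U --> F] --> sound gamma U0.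
Proof.
have [p0 r0 _] := sup.
have H : gamma * pres U / dens U @[U --> F] --> gamma * pres U0 / dens U0.
  apply: cvgM; first by apply: cvgM; [exact: cvg_cst|exact: pres_cvg].
  by apply: cvgV; [rewrite gt_eqF|exact: dens_cvg].
exact: (cvg_comp _ _ H (@sqrt_continuous R _)).
Qed.

Let c0 : 0 < sound gamma U0.
Proof.
by have [p0 r0 _] := sup; have [] := sound_gt0 (lt_trans ltr01 gamma1) p0 r0.
Qed.

Let u0 : 0 < velx U0.
Proof. by have [_ _ cu] := sup; exact: lt_trans cu. Qed.

Lemma lambda2_cvg : lambda2 U @[U --> F] --> lambda2 U0.
Proof.
apply: cvgM; first exact: vely_cvg.
by apply: cvgV; [rewrite gt_eqF|exact: velx_cvg].
Qed.

Lemma lambda_cvg j : lambda gamma j U @[U --> F] --> lambda gamma j U0.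
Proof.
have [_ _ cu] := sup.
have sq (f : 'rV[R]_4 -> R) (a : R) : f U @[U --> F] --> a ->
  f U ^+ 2 @[U --> F] --> a ^+ 2 by move=> fa; exact: cvgM.
apply: cvgM; last first.
  apply: cvgV; last by apply: cvgB; apply: sq; [exact: velx_cvg|exact: sound_cvg].
  by rewrite gt_eqF // subr_gt0 ltr_pXn2r // nnegrE ltW.
apply: cvgD; first by apply: cvgM; [exact: velx_cvg|exact: vely_cvg].
have H : velx U ^+ 2 + vely U ^+ 2 - sound gamma U ^+ 2 @[U --> F] -->
    velx U0 ^+ 2 + vely U0 ^+ 2 - sound gamma U0 ^+ 2.
  apply: cvgB; last by apply: sq; exact: sound_cvg.
  by apply: cvgD; apply: sq; [exact: velx_cvg|exact: vely_cvg].
apply: cvgM; first by apply: cvgM; [exact: cvg_cst|exact: sound_cvg].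
exact: (cvg_comp _ _ H (@sqrt_continuous R _)).
Qed.

Lemma supersonic_near : \forall U \near F, supersonic gamma U.
Proof.
have [p0 r0 cu] := sup.
have P : \forall U \near F, 0 < pres U by exact: (cvgr_gt _ pres_cvg).
have D : \forall U \near F, 0 < dens U by exact: (cvgr_gt _ dens_cvg).
have C : \forall U \near F, 0 < velx U - sound gamma U.
  by apply: (cvgr_gt _ (cvgB velx_cvg sound_cvg)); rewrite subr_gt0.
near=> U; split; [by near: U|by near: U|].
by rewrite -subr_gt0; near: U.
Unshelve. all: by end_near. Qed.

End limits.

Lemma shock4_open (s0 : R) Um Ua : shock gamma 4 s0 Um Ua ->
  exists2 r : R, 0 < r & forall s U V,
    `|s - s0| < r -> `|U - Um| < r -> `|V - Ua| < r ->
    [/\ supersonic gamma U, supersonic gamma V,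
      lambda gamma 4 V < s < lambda gamma 4 U & lambda2 V < s].
Proof.
move=> [supm supa _ /andP[la lm] [_ /(_ erefl) l2]].
(* Thresholds at the midpoints of the strict inequalities let the speed and the two states vary
   independently. *)
have mid (a b : R) : a < b -> a < (a + b) / 2 /\ (a + b) / 2 < b.
  by move=> ab; split; lra.
have [a1 a2] := mid _ _ la; have [m1 m2] := mid _ _ lm; have [b1 b2] := mid _ _ l2.
have nm : \forall U \near Um, supersonic gamma U /\
    (s0 + lambda gamma 4 Um) / 2 < lambda gamma 4 U.
  apply: filterI; first exact: (@supersonic_near Um (nbhs Um) _ cvg_id supm).
  exact: (cvgr_gt _ (@lambda_cvg Um (nbhs Um) _ cvg_id supm 4)).
have na : \forall V \near Ua, (supersonic gamma V /\
    lambda gamma 4 V < (lambda gamma 4 Ua + s0) / 2) /\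
    lambda2 V < (lambda2 Ua + s0) / 2.
  apply: filterI; first apply: filterI.
  - exact: (@supersonic_near Ua (nbhs Ua) _ cvg_id supa).
  - exact: (cvgr_lt _ (@lambda_cvg Ua (nbhs Ua) _ cvg_id supa 4)).
  exact: (cvgr_lt _ (@lambda2_cvg Ua (nbhs Ua) _ cvg_id supa)).
have ns : \forall s \near s0, ((lambda gamma 4 Ua + s0) / 2 < s /\
    s < (s0 + lambda gamma 4 Um) / 2) /\ (lambda2 Ua + s0) / 2 < s.
  apply: filterI; first apply: filterI.
  - exact: (cvgr_gt s0 cvg_id).
  - exact: (cvgr_lt s0 cvg_id).
  exact: (cvgr_gt s0 cvg_id).
have [r1 r10 H1] := near_ball nm; have [r2 r20 H2] := near_ball na.
have [r3 r30 H3] := near_ball ns.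
exists (Num.min r1 (Num.min r2 r3)); first by rewrite !lt_min r10 r20 r30.
move=> s U V; rewrite !lt_min => /and3P[_ _ /H3[[s1 s2] s3]].
move=> /and3P[/H1[U1 U2] _ _] /and3P[_ /H2[[V1 V2] V3] _].
by split=> //; [rewrite (lt_trans V2) // (lt_trans s2)|rewrite (lt_trans V3)].
Qed.

End shock_conditions.

(** Equips matrices with the completeness structure that [banach_fixed_point] asks for. *)
HB.instance Definition _ (R : realType) m n :=
  Uniform_isComplete.Build 'M[R]_(m, n) (@cauchy_cvg _).

Lemma contraction_fixed_point (R : realType) n (f : 'rV[R]_n -> 'rV[R]_n) a
    (r k : R) : 0 <= r -> 0 <= k < 1 ->
  (forall x, `|x - a| <= r -> `|f x - a| <= r) ->
  (forall x y, `|x - a| <= r -> `|y - a| <= r ->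
    `|f x - f y| <= k * `|x - y|) ->
  exists2 x, `|x - a| <= r & f x = x.
Proof.
move=> r0 /andP[k0 k1] fr fk.
pose B := closed_ball_ (fun x : 'rV[R]_n => `|x|) a r.
have BE x : B x <-> `|x - a| <= r by rewrite /B /closed_ball_ /= distrC.
have fB : set_fun B B f by move=> x /BE xr; apply/BE; exact: fr.
pose g : {fun B >-> B} := HB.pack f (isFun.Build _ _ B B f fB).
have [|||x Bx xE] := @banach_fixed_point R 'rV[R]_n B g.
- exists (NngNum k0); split=> //= -[x y] [/= /BE xr /BE yr].
  exact: fk.
- exact: closed_closed_ball_.
- by exists a; apply/BE; rewrite subrr normr0.
by exists x; [apply/BE|rewrite [RHS]xE].
Qed.

(** * The Rankine-Hugoniot residual *)

Section residual.
Context {R : realType} (gamma : R).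

Lemma linear_norm_le n m (f : 'rV[R]_n -> 'rV[R]_m) : linear f ->
  exists2 C : R, 0 < C & forall x, `|f x| <= C * `|x|.
Proof.
move=> flin; pose fL : {linear 'rV[R]_n -> 'rV[R]_m} :=
  HB.pack f (GRing.isLinear.Build R 'rV[R]_n 'rV[R]_m *:%R f flin).
have [C C0 H] := mulmx_norm_le (lin1_mx fL).
by exists C => // x; have := H x; rewrite mul_rV_lin1.
Qed.

Lemma shock_flux_diffD s U ds dU dU' :
  shock_flux_diff gamma s U ds (dU + dU') =
  shock_flux_diff gamma s U 0 dU + shock_flux_diff gamma s U ds dU'.
Proof.
have := shock_flux_diff_linear gamma s U 1 0 dU ds dU'.
by rewrite !scale1r mul1r add0r.
Qed.

Lemma shock_flux_diff00 s U : shock_flux_diff gamma s U 0 0 = 0.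
Proof.
have := shock_flux_diff_linear gamma s U (-1) 0 0 0 0.
by rewrite mulr0 scaler0 !addr0 scaleN1r addNr.
Qed.

Lemma shock_flux_diffZ s U ds dU :
  shock_flux_diff gamma s U 0 (ds *: dU) = ds *: shock_flux_diff gamma s U 0 dU.
Proof.
have := shock_flux_diff_linear gamma s U ds 0 dU 0 0.
by rewrite mulr0 shock_flux_diff00 !addr0.
Qed.

Lemma shock_flux_diff_speed s U ds :
  shock_flux_diff gamma s U ds 0 = ds *: shock_flux_diff gamma s U 1 0.
Proof.
have := shock_flux_diff_linear gamma s U ds 1 0 0 0.
by rewrite scaler0 mulr1 shock_flux_diff00 !addr0.
Qed.

Lemma shock_flux_diff_norm_le s U :
  exists2 C : R, 0 < C & forall dU, `|shock_flux_diff gamma s U 0 dU| <= C * `|dU|.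
Proof.
by apply: linear_norm_le => a x y; rewrite shock_flux_diffD shock_flux_diffZ.
Qed.

Lemma shock_flux_continuous s U (e : R) : 0 < e -> exists2 r : R, 0 < r &
  forall X, `|X - U| < r -> `|shock_flux gamma s X - shock_flux gamma s U| < e.
Proof.
move=> e0; have [C C0 HC] := shock_flux_diff_norm_le s U.
have [r r0 H] := shock_flux_strict gamma s U ltr01.
have C1 : 0 < 1 + C by rewrite addr_gt0.
exists (Num.min r (e / (1 + C))); first by rewrite lt_min r0 divr_gt0.
move=> X; rewrite lt_min => /andP[Xr Xe].
have := H s s X U; rewrite !subrr !normr0 r0 => /(_ isT isT Xr isT).
rewrite (max_r (normr_ge0 _)) => H1.
rewrite -(subrK (shock_flux_diff gamma s U 0 (X - U)) (_ - _)).
apply: le_lt_trans (ler_normD _ _) _.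
apply: le_lt_trans (lerD H1 (HC _)) _.
by rewrite -mulrDl mulrC -ltr_pdivlMr.
Qed.

(** The defect in the Rankine-Hugoniot relations between the state reached from [U] and the state
    [V], at the unknown speed [dens q]. *)
Definition residual (Phi : R -> 'rV[R]_4 -> 'rV[R]_4) (q U V : 'rV[R]_4) :
    'rV[R]_4 :=
  shock_flux gamma (dens q) (wave_states Phi q U) - shock_flux gamma (dens q) V.

Variables (Um Ua : 'rV[R]_4) (s0 : R) (Phi : R -> 'rV[R]_4 -> 'rV[R]_4).
Hypothesis Phi_lax : lax_curve gamma 1 Um Phi.

Let qb : 'rV[R]_4 := vec4 0 0 0 s0.

Let qbE : [/\ velx qb = 0, vely qb = 0, pres qb = 0 & dens qb = s0].
Proof. exact: vec4E. Qed.

(** The chain rule for strict differentials. One linear map, taken at the background, serves all [U]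
    and [V] in the neighbourhoods. *)
Lemma residual_strict (e : R) : 0 < e -> exists2 r : R, 0 < r &
  forall q q' U V, `|q - qb| < r -> `|q' - qb| < r ->
    `|U - Um| < r -> `|V - Ua| < r ->
  `|residual Phi q U V - residual Phi q' U V
    - strong_diff gamma Um Ua s0 (q - q')| <= e * `|q - q'|.
Proof.
move=> e0; have [qb0 qb1 qb2 qb3] := qbE.
have [C1 C10 HC1] := linear_norm_le (wave_states_diff_linear gamma Um 1).
have [C2 C20 HC2] := shock_flux_diff_norm_le s0 Um.
have K0 : 0 < 2 * (C1 + 2) by rewrite mulr_gt0 // addr_gt0.
(* Half of [e] pays for the two flux errors, with factors [C1 + 1] and 1; the other half pays for
   the wave error, amplified by [C2]. *)
pose e1 := e / (2 * (C1 + 2)).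
have e10 : 0 < e1 by rewrite divr_gt0.
pose e2 := Num.min 1 (e / (2 * C2)).
have e20 : 0 < e2 by rewrite lt_min ltr01 divr_gt0 // mulr_gt0.
have [r1 r10 H1] := shock_flux_strict gamma s0 Um e10.
have [r2 r20 H2] := shock_flux_strict gamma s0 Ua e10.
have [r3 r30 H3] := wave_states_strict Phi_lax qb0 qb1 qb2 e20.
have [r4 r40 H4] := wave_states_continuous Phi_lax qb0 qb1 qb2 r10.
exists (Num.min (Num.min r1 r2) (Num.min r3 r4)).
  by rewrite !lt_min r10 r20 r30.
move=> q q' U V; rewrite !lt_min.
move=> /andP[/andP[q1 q2] /andP[q3 q4]] /andP[/andP[p1 p2] /andP[p3 p4]].
move=> /andP[/andP[U1 U2] /andP[U3 U4]] /andP[/andP[V1 V2] /andP[V3 V4]].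
rewrite /residual /strong_diff.
set w := wave_states Phi q U; set w' := wave_states Phi q' U.
have sE : dens (q - q') = dens q - dens q' by rewrite /dens !mxE.
have dq (x : 'rV[R]_4) : `|dens x - s0| <= `|x - qb|.
  have -> : dens x - s0 = (x - qb) 0 (inord 3); last exact: coord_le_norm.
  transitivity (dens x - dens qb); first by rewrite qb3.
  by rewrite /dens [RHS]mxE [in RHS]mxE.
set ds := dens (q - q'); set n := `|q - q'|.
have dsn : `|ds| <= n by exact: coord_le_norm.
set dT := wave_states_diff gamma 1 Um (q - q').
have B3 : `|w - w' - dT| <= e2 * n by exact: H3.
have n0 : 0 <= n := normr_ge0 _.
have wn : `|w - w'| <= (C1 + 1) * n.
  rewrite -(subrK dT (w - w')) mulrDl addrC.
  apply: le_trans (ler_normD _ _) (lerD (HC1 _) _).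
  by apply: le_trans B3 _; rewrite ler_wpM2r // /e2 ge_min lexx.
have B1 : `|shock_flux gamma (dens q) w - shock_flux gamma (dens q') w' -
    shock_flux_diff gamma s0 Um ds (w - w')| <= e1 * ((C1 + 1) * n).
  rewrite /ds sE; apply: le_trans (H1 _ _ _ _ _ _ _ _) _.
  - exact: le_lt_trans (dq _) q1.
  - exact: le_lt_trans (dq _) p1.
  - exact: H4.
  - exact: H4.
  rewrite ler_wpM2l ?(ltW e10) // -sE ge_max wn andbT (le_trans dsn) //.
  by rewrite ler_peMl // lerDr ltW.
have B2 : `|shock_flux gamma (dens q) V - shock_flux gamma (dens q') V -
    ds *: shock_flux_diff gamma s0 Ua 1 0| <= e1 * n.
  have := H2 (dens q) (dens q') V V.
  rewrite subrr (shock_flux_diff_speed _ _ (_ - _)) normr0 (max_l (normr_ge0 _)) -sE => H.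
  apply: le_trans (H _ _ _ _) _ => //.
  - exact: le_lt_trans (dq _) q2.
  - exact: le_lt_trans (dq _) p2.
  by rewrite ler_wpM2l // ltW.
(* Linearity separates the error of the wave map from its differential [dT]. *)
have E : shock_flux_diff gamma s0 Um ds (w - w') =
    shock_flux_diff gamma s0 Um 0 (w - w' - dT) + shock_flux_diff gamma s0 Um ds dT.
  by rewrite -shock_flux_diffD subrK.
rewrite E in B1.
have B4 : `|shock_flux_diff gamma s0 Um 0 (w - w' - dT)| <= C2 * (e2 * n).
  by apply: le_trans (HC2 _) _; rewrite ler_wpM2l // ltW.
move: B1 B2 B4.
set a := shock_flux gamma (dens q) w; set a' := shock_flux gamma (dens q') w'.
set b := shock_flux gamma (dens q) V; set b' := shock_flux gamma (dens q') V.
set x := shock_flux_diff _ _ _ 0 _; set y := shock_flux_diff _ _ _ ds dT.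
set z := ds *: _; move=> B1 B2 B4.
have -> : a - b - (a' - b') - (y - z) = (a - a' - (x + y)) - (b - b' - z) + x.
  by apply/rowP => i; rewrite !mxE; ring.
apply: le_trans (ler_normD _ _) _.
apply: le_trans (lerD (ler_normB _ _) B4) _.
apply: le_trans (lerD (lerD B1 B2) (lexx _)) _.
have -> : e1 * ((C1 + 1) * n) + e1 * n = e / 2 * n.
  by rewrite /e1; field; rewrite gt_eqF // addr_gt0.
have -> : e * n = e / 2 * n + e / 2 * n by rewrite -mulrDl -splitr.
rewrite lerD2l mulrA ler_wpM2r //.
apply: (@le_trans _ _ (C2 * (e / (2 * C2)))).
  by rewrite ler_pM2l // /e2 ge_min lexx orbT.
by rewrite le_eqVlt; apply/orP; left; apply/eqP; field; rewrite gt_eqF.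
Qed.

Lemma residual_base_continuous (e : R) :
  shock_flux gamma s0 Um = shock_flux gamma s0 Ua -> 0 < e ->
  exists2 r : R, 0 < r & forall U V, `|U - Um| < r -> `|V - Ua| < r ->
    `|residual Phi qb U V| < e.
Proof.
move=> RH e0; have [qb0 qb1 qb2 qb3] := qbE.
have e20 : 0 < e / 2 by rewrite divr_gt0.
have [r1 r10 H1] := shock_flux_continuous s0 Um e20.
have [r2 r20 H2] := shock_flux_continuous s0 Ua e20.
have [r3 r30 H3] := wave_states_continuous Phi_lax qb0 qb1 qb2 r10.
exists (Num.min r2 r3); first by rewrite lt_min r20.
move=> U V; rewrite !lt_min => /andP[U2 U3] /andP[V2 V3].
rewrite /residual qb3 (splitr e); set A := shock_flux _ _ _; set B := shock_flux _ _ V.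
have -> : A - B = (A - shock_flux gamma s0 Um) - (B - shock_flux gamma s0 Ua).
  by rewrite -RH opprB addrA subrK.
apply: le_lt_trans (ler_normB _ _) _; apply: ltrD; last exact: H2.
by apply: H1; apply: H3; rewrite ?subrr ?normr0.
Qed.

End residual.

(** * Interaction of weak waves *)

Section interaction.
Context {R : realType}.

Definition rescale (a b : R) (X : 'rV[R]_4) : 'rV[R]_4 := Phi3 b (Phi2 a X).

Lemma rescaleE a b X : rescale a b X =
  vec4 (velx X * expR a) (vely X * expR a) (pres X) (dens X * expR b).
Proof. by rewrite /rescale /Phi3 /Phi2 !vec4K. Qed.

Lemma rescale_linear a b : linear (rescale a b).
Proof.
move=> t X Y; have [E1 E2 E3 E4] := state_linear t X Y.
by rewrite !rescaleE E1 E2 E3 E4 vec4Z vec4D; congr vec4; ring.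
Qed.

Lemma rescaleB a b X Y : rescale a b (X - Y) = rescale a b X - rescale a b Y.
Proof.
have := rescale_linear a b (-1) Y X; rewrite !scaleN1r => H.
by rewrite addrC H addrC.
Qed.

Lemma rescale_add a b a' b' X :
  rescale (a + a') (b + b') X = rescale a b (rescale a' b' X).
Proof. by rewrite !rescaleE !vec4K !expRD; congr vec4; ring. Qed.

(** The factor 2 arises because [expR c - 1] is [c] up to an error of at most [|c|]. *)
Lemma rescale_near_id : exists2 r : R, 0 < r & forall a b X,
  `|a| < r -> `|b| < r ->
  `|rescale a b X - X| <= 2 * (`|a| + `|b|) * `|X|.
Proof.
have [r r0 H] := expR_strict (@ltr01 R).
exists r => // a b X ar br.
have E c : `|c| < r -> `|expR c - 1| <= 2 * `|c|.
  move=> cr; have := H c 0; rewrite !subr0 normr0 expR0 !mul1r => /(_ cr r0).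
  move=> Hc; rewrite -(subrK c (expR c - 1)) mulr2n mulrDl mul1r.
  by apply: le_trans (ler_normD _ _) _; rewrite lerD2r.
have B c i : `|c| < r -> `|c| <= `|a| + `|b| ->
    `|X 0 i * expR c - X 0 i| <= 2 * (`|a| + `|b|) * `|X|.
  move=> cr cab; rewrite -[X in _ - X]mulr1 -mulrBr normrM mulrC.
  apply: ler_pM => //; last exact: coord_le_norm.
  by apply: le_trans (E _ cr) _; rewrite ler_wpM2l.
rewrite rescaleE [V in _ - V](stateE X) vec4B; apply: vec4_norm_le.
- by apply: B => //; rewrite lerDl.
- by apply: B => //; rewrite lerDl.
- by rewrite subrr normr0 !mulr_ge0 ?addr_ge0.
- by apply: B => //; rewrite lerDr.
Qed.

Variables (gamma : R) (j j' : nat) (Um : 'rV[R]_4).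
Variables (Phi Psi : R -> 'rV[R]_4 -> 'rV[R]_4).
Hypotheses (Phi_lax : lax_curve gamma j Um Phi).
Hypotheses (Psi_lax : lax_curve gamma j' Um Psi).

(* [rescale] is exactly multiplicative and linear, so the only commutator is
   that of [Phi b1] with [rescale a2 a3]; it vanishes with either factor. *)
Lemma interaction_estimate : exists2 M : R, 0 < M &
  forall e : R, 0 < e -> exists2 r : R, 0 < r &
  forall (U1 U2 : 'rV[R]_4) (a2 a3 a4 b1 b2 b3 : R),
    `|U1 - Um| < r -> `|U2 - Um| < r ->
    [/\ `|a2| < r, `|a3| < r & `|a4| < r] ->
    [/\ `|b1| < r, `|b2| < r & `|b3| < r] ->
    U2 = Psi a4 (rescale a2 a3 U1) ->
    `|rescale (b2 + a2) (b3 + a3) (Phi b1 U1) - rescale b2 b3 (Phi b1 U2)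
      + a4 *: eigvec gamma j' Um| <=
    e * `|a4| + M * (`|b1| * (`|a2| + `|a3|)).
Proof.
pose k1 := `|eigvec gamma j Um|; pose k4 := `|eigvec gamma j' Um|.
have k10 : 0 <= k1 := normr_ge0 _; have k40 : 0 <= k4 := normr_ge0 _.
pose N := `|Um| + 1; have N0 : 0 < N by rewrite ltr_wpDl.
have [C [rD [C0 rD0 HD]]] := lax_mixed Phi_lax.
pose M0 := 2 * (1 + k1) + 2 * C * N.
have M00 : 0 < M0 by rewrite ltr_pwDl // ?mulr_gt0 ?ltr_pwDl // !mulr_ge0 // ltW.
(* [M0] bounds the commutator; the outer rescaling by [b2], [b3] at most doubles it. *)
exists (2 * M0); first by rewrite mulr_gt0.
move=> e e0; pose e1 := Num.min 1 (e / (4 * (k4 + 2))).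
have k42 : 0 < k4 + 2 by rewrite ltr_wpDl.
have e10 : 0 < e1 by rewrite lt_min ltr01 divr_gt0 // mulr_gt0.
have e1e : 2 * e1 * (k4 + 2) <= e / 2.
  have : e1 <= e / (4 * (k4 + 2)) by rewrite /e1 ge_min lexx orbT.
  rewrite ler_pdivlMr ?mulr_gt0 //; lra.
have e11 : e1 <= 1 by rewrite /e1 ge_min lexx.
have [rE rE0 HE] := rescale_near_id.
have [rA rA0 HA] := lax_strict Phi_lax ltr01.
have [rB rB0 HB] := lax_strict Phi_lax e10.
have [rC rC0 HC] := lax_strict Psi_lax e10.
have [rF rF0 HF] := lax_curve0 Phi_lax.
have [rG rG0 HG] := lax_curve0 Psi_lax.
pose r0 := Num.min (Num.min (Num.min rA rB) (Num.min rC rD))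
  (Num.min (Num.min rE rF) (Num.min rG 1)).
have r00 : 0 < r0 by rewrite !lt_min rA0 rB0 rC0 rD0 rE0 rF0 rG0 ltr01.
(* The three bounds keep [Y] within [r0] of [Um], ensure [2 * sb <= 1], and make the outer rescaling
   move the eigenvector by at most [e / 2]. *)
pose r := Num.min (Num.min (r0 / (4 * N + 1)) (1 / 4)) (e / (8 * (k4 + 1))).
have k41 : 0 < k4 + 1 by rewrite ltr_wpDl.
have N4 : 0 < 4 * N + 1 by rewrite addr_gt0 // mulr_gt0.
exists r; first by rewrite !lt_min !divr_gt0 // mulr_gt0.
move=> U1 U2 a2 a3 a4 b1 b2 b3.
have rr0 : r * (4 * N + 1) <= r0.
  by rewrite -ler_pdivlMr // /r !ge_min lexx.
have r4 : r <= 1 / 4 by rewrite /r !ge_min lexx orbT.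
have rke : r * (8 * (k4 + 1)) <= e.
  by rewrite -ler_pdivlMr ?mulr_gt0 // /r !ge_min lexx !orbT.
have r_gt0 : 0 < r by rewrite !lt_min !divr_gt0 // mulr_gt0.
have rr : r + r * (4 * N) <= r0 by move: rr0; rewrite mulrDr mulr1 addrC.
have rN0 : 0 <= r * (4 * N) by rewrite !mulr_ge0 // ltW.
have small (x : R) : x < r -> [/\ [/\ x < rA, x < rB, x < rC & x < rD],
    [/\ x < rE, x < rF, x < rG & x < 1] & x < r0].
  move=> xr; have : x < r0 by move: xr rr rN0; clear; lra.
  by rewrite /r0 !lt_min => H; move: (H)
    => /andP[/andP[/andP[? ?] /andP[? ?]] /andP[/andP[? ?] /andP[? ?]]].
have small0 (x : R) : x < r0 -> [/\ x < rB, x < rC, x < rD & x < rG].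
  by rewrite /r0 !lt_min =>
    /andP[/andP[/andP[? ?] /andP[? ?]] /andP[/andP[? ?] /andP[? ?]]].
move=> U1r U2r [a2r a3r a4r] [b1r b2r b3r] U2E.
set Y := rescale a2 a3 U1 in U2E.
pose sa := `|a2| + `|a3|; pose sb := `|b2| + `|b3|.
have sa0 : 0 <= sa by rewrite addr_ge0.
have sb0 : 0 <= sb by rewrite addr_ge0.
have [[U1A U1B U1C U1D] [U1E U1F U1G U11] _] := small _ U1r.
have [[U2A U2B U2C U2D] _ _] := small _ U2r.
have [[a2A a2B a2C a2D] [a2E _ _ _] _] := small _ a2r.
have [[_ _ _ _] [a3E _ _ _] _] := small _ a3r.
have [[_ _ a4C _] _ _] := small _ a4r.
have [[b1A b1B b1C b1D] _ _] := small _ b1r.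
have [[_ _ _ _] [b2E _ _ _] _] := small _ b2r.
have [[_ _ _ _] [b3E _ _ _] _] := small _ b3r.
have U1N : `|U1| <= N.
  rewrite -(subrK Um U1) /N addrC; apply: le_trans (ler_normD _ _) _.
  by rewrite lerD2l ltW.
have YU : `|Y - U1| <= 2 * sa * N.
  by apply: le_trans (HE _ _ _ a2E a3E) _; rewrite ler_wpM2l // ?mulr_ge0.
have Yr0 : `|Y - Um| < r0.
  rewrite -(subrK U1 Y) -addrA; apply: le_lt_trans (ler_normD _ _) _.
  have : 2 * sa * N <= r * (4 * N).
    rewrite -mulrA mulrCA [leRHS]mulrA; rewrite mulrA; apply: ler_wpM2r; first exact: ltW.
    by move: a2r a3r; rewrite /sa; clear; lra.
  by move: YU U1r rr; clear; lra.
have [YB YC YD YG] := small0 _ Yr0.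
have Z : `|Phi b1 U1 - U1| <= (1 + k1) * `|b1|.
  have := HA b1 0 U1 U1; rewrite normr0 HF // !subrr addr0 subr0 normr0.
  rewrite (max_l (normr_ge0 _)) => /(_ b1A rA0 U1A U1A) H.
  rewrite -(subrK (b1 *: eigvec gamma j Um) (_ - U1)) mulrDl.
  apply: le_trans (ler_normD _ _) (lerD _ _); first exact: H.
  by rewrite normrZ mulrC.
have T1 : `|rescale a2 a3 (Phi b1 U1 - U1) - (Phi b1 U1 - U1)| <=
    2 * sa * ((1 + k1) * `|b1|).
  by apply: le_trans (HE _ _ _ a2E a3E) _; rewrite ler_wpM2l // mulr_ge0.
have T2 : `|(Phi b1 U1 - U1) - (Phi b1 Y - Y)| <= C * `|b1| * (2 * sa * N).
  apply: le_trans (HD _ _ _ b1D U1D YD) _; rewrite distrC ler_wpM2l //.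
  by rewrite mulr_ge0 // ltW.
have T4 : `|U2 - Y - a4 *: eigvec gamma j' Um| <= e1 * `|a4|.
  have := HC a4 0 Y Y; rewrite normr0 HG // !subrr addr0 subr0 normr0 -U2E.
  by rewrite (max_l (normr_ge0 _)) => /(_ a4C rC0 YC YC).
have UY : `|U2 - Y| <= (k4 + 1) * `|a4|.
  rewrite -(subrK (a4 *: eigvec gamma j' Um) (U2 - Y)) mulrDl mul1r addrC.
  apply: le_trans (ler_normD _ _) (lerD _ _); first by rewrite normrZ mulrC.
  by apply: le_trans T4 _; rewrite ler_piMl.
have T3 : `|Phi b1 Y - Phi b1 U2 - (Y - U2)| <= e1 * ((k4 + 1) * `|a4|).
  have := HB b1 b1 Y U2; rewrite subrr scale0r add0r normr0.
  rewrite (max_r (normr_ge0 _)) => /(_ b1B b1B YB U2B) H.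
  by apply: le_trans H _; rewrite distrC ler_wpM2l // ltW.
pose D := rescale a2 a3 (Phi b1 U1) - Phi b1 U2.
pose w := eigvec gamma j' Um.
(* The first two terms form the commutator and are of order |b1| (|a2| + |a3|). The last two compare
   [Y] with [U2] across the 4-wave and are small multiples of |a4|. *)
have DE : D + a4 *: w = (rescale a2 a3 (Phi b1 U1 - U1) - (Phi b1 U1 - U1))
   + ((Phi b1 U1 - U1) - (Phi b1 Y - Y)) + (Phi b1 Y - Phi b1 U2 - (Y - U2))
   - (U2 - Y - a4 *: w).
  by rewrite rescaleB -/Y /D; apply/rowP => i; rewrite !mxE; ring.
have DB : `|D + a4 *: w| <= M0 * (`|b1| * sa) + e1 * (k4 + 2) * `|a4|.
  rewrite DE; apply: le_trans (ler_normB _ _) _.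
  apply: le_trans (lerD (ler_normD _ _) (lexx _)) _.
  apply: le_trans (lerD (lerD (ler_normD _ _) (lexx _)) (lexx _)) _.
  apply: le_trans (lerD (lerD (lerD T1 T2) T3) T4) _.
  by rewrite le_eqVlt; apply/orP; left; apply/eqP; rewrite /M0; ring.
have rsb : 2 * sb <= 1 by move: b2r b3r r4; rewrite /sb; clear; lra.
rewrite !rescale_add -/Y -rescaleB -/D -/w.
(* Reduces to the previous bound: the outer rescaling is close to the identity, both on the error
   and on [w]. *)
have -> : rescale b2 b3 D + a4 *: w =
    (rescale b2 b3 (D + a4 *: w) - (D + a4 *: w)) + (D + a4 *: w)
    - a4 *: (rescale b2 b3 w - w).
  have := rescale_linear b2 b3 a4 w D; rewrite [a4 *: w + D]addrC => ->.
  by apply/rowP => i; rewrite !mxE; ring.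
apply: le_trans (ler_normB _ _) _; rewrite normrZ.
apply: le_trans (lerD (ler_normD _ _) (lexx _)) _.
have R1 : `|rescale b2 b3 (D + a4 *: w) - (D + a4 *: w)| <= `|D + a4 *: w|.
  by apply: le_trans (HE _ _ _ b2E b3E) _; rewrite ler_piMl.
have R2 : `|a4| * `|rescale b2 b3 w - w| <= e / 2 * `|a4|.
  rewrite mulrC ler_wpM2r //; apply: le_trans (HE _ _ _ b2E b3E) _.
  rewrite -/w -/k4 -/sb.
  have : 2 * sb * k4 <= 4 * r * k4.
    by rewrite ler_wpM2r //; move: b2r b3r; rewrite /sb; clear; lra.
  by move: r_gt0 rke; clear; lra.
have : 2 * e1 * (k4 + 2) * `|a4| <= e / 2 * `|a4| by rewrite ler_wpM2r.
by rewrite -/sa; move: R1 R2 DB; clear; lra.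
Qed.

End interaction.

(** * Solving and expanding the residual equation *)

Section strong_interaction.
Context {R : realType} (gamma : R) (Um Ua : 'rV[R]_4) (s0 : R).
Hypothesis gamma1 : 1 < gamma.
Hypotheses (Um_axis : vely Um = 0) (strong : shock gamma 4 s0 Um Ua).
Variables Phi1 Phi4 : R -> 'rV[R]_4 -> 'rV[R]_4.
Hypothesis Phi1_lax : lax_curve gamma 1 Um Phi1.
Hypothesis Phi4_lax : lax_curve gamma 4 Um Phi4.

Local Notation qb := (vec4 0 0 0 s0 : 'rV[R]_4).
Local Notation L := (strong_diff gamma Um Ua s0).
Local Notation res := (residual gamma Phi1).

Lemma strong_rankine_hugoniot : shock_flux gamma s0 Um = shock_flux gamma s0 Ua.
Proof.
have [[_ rm _] [_ ra _] RH _ _] := strong.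
by apply/rankine_hugoniotP => //; rewrite gt_eqF.
Qed.

Lemma strong_diff_eq0 x : L x = 0 -> x = 0.
Proof.
move=> Lx; have E : L x = 0 *: shock_flux_diff gamma s0 Um 0 (eigvec gamma 4 Um).
  by rewrite Lx scale0r.
by have [_ ->] := strong_diff_solve gamma1 Um_axis strong E.
Qed.

Lemma strong_diff_inv : exists g : {linear 'rV[R]_4 -> 'rV[R]_4},
  [/\ cancel L g, cancel g L &
    exists2 C : R, 0 < C & forall x, `|g x| <= C * `|x|].
Proof.
exact: injective_linear_inv (@strong_diff_linear R gamma Um Ua s0)
  strong_diff_eq0.
Qed.

(** Injectivity of the differential in quantitative form: the strict error is kept below half of |q
    - q'| and absorbed on the left. It yields uniqueness and the a priori size of a correction. *)
Lemma residual_expanding : exists C r : R, [/\ 0 < C, 0 < r &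
  forall q q' U V, `|q - qb| < r -> `|q' - qb| < r ->
    `|U - Um| < r -> `|V - Ua| < r ->
  `|q - q'| <= C * `|res q U V - res q' U V|].
Proof.
have [g [Lg gL [C C0 HC]]] := strong_diff_inv.
have e0 : 0 < (2 * C)^-1 by rewrite invr_gt0 mulr_gt0.
have [r r0 H] := residual_strict Ua s0 Phi1_lax e0.
exists (2 * C), r; split; rewrite ?mulr_gt0 // => q q' U V qr q'r Ur Vr.
have := HC (L (q - q')); rewrite Lg => H1.
have := H q q' U V qr q'r Ur Vr.
move=> H2.
have H3 : `|L (q - q')| <= `|res q U V - res q' U V| + (2 * C)^-1 * `|q - q'|.
  rewrite -(subKr (res q U V - res q' U V) (L _)).
  by apply: le_trans (ler_normB _ _) _; rewrite lerD2l.
have H4 := le_trans H1 (ler_wpM2l (ltW C0) H3).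
have E : C * ((2 * C)^-1 * `|q - q'|) = `|q - q'| / 2.
  by field; rewrite gt_eqF.
by move: H4; rewrite mulrDr E; lra.
Qed.

(** Newton iteration with the derivative frozen at the background: [q - g (res q U V)] contracts by
    1/2, and its fixed points are zeros because [g] is injective. *)
Lemma residual_zero : exists2 r : R, 0 < r &
  forall eta : R, 0 < eta <= r -> exists2 eps : R, 0 < eps &
  forall U V, `|U - Um| < eps -> `|V - Ua| < eps ->
  exists2 q, `|q - qb| < eta & res q U V = 0.
Proof.
have [g [Lg gL [C C0 HC]]] := strong_diff_inv.
have e0 : 0 < (2 * C)^-1 by rewrite invr_gt0 mulr_gt0.
have [r r0 H] := residual_strict Ua s0 Phi1_lax e0.
exists r => // eta /andP[eta0 etar].
(* The base point then moves by at most [eta / 4], and contraction adds another [eta / 4]: the ball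
   of radius [eta / 2] is preserved. *)
have e1 : 0 < eta / (4 * C) by rewrite divr_gt0 // mulr_gt0.
have [r1 r10 H1] := residual_base_continuous Phi1_lax strong_rankine_hugoniot e1.
exists (Num.min r r1); first by rewrite lt_min r0.
move=> U V; rewrite !lt_min => /andP[Ur Ur1] /andP[Vr Vr1].
pose f q := q - g (res q U V).
have half (x y : 'rV[R]_4) : `|x - qb| < r -> `|y - qb| < r ->
    `|f x - f y| <= 1 / 2 * `|x - y|.
  move=> xr yr.
  have -> : f x - f y = - g (res x U V - res y U V - L (x - y)).
    have G p q w : g (p - q - w) = g p - g q - g w by rewrite !linearB.
    rewrite G Lg /f; apply/rowP => i; rewrite !mxE; ring.
  rewrite normrN; apply: le_trans (HC _) _.
  have := H x y U V xr yr Ur Vr.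
  rewrite -(ler_pM2l C0) => /le_trans; apply.
  by rewrite le_eqVlt; apply/orP; left; apply/eqP; field; rewrite gt_eqF.
have eta2 : 0 < eta / 2 by rewrite divr_gt0.
have inr (x : 'rV[R]_4) : `|x - qb| <= eta / 2 -> `|x - qb| < r.
  by move=> xe; lra.
have qbr : `|qb - qb| < r by rewrite subrr normr0.
have [||||q qr qE] := @contraction_fixed_point R 4 f qb (eta / 2) (1 / 2).
- exact: ltW.
- by apply/andP; split; lra.
- move=> x xe; rewrite -(subrK (f qb) (f x)) -addrA.
  apply: le_trans (ler_normD _ _) _.
  have := half x qb (inr x xe) qbr.
  have -> : f qb - qb = - g (res qb U V) by rewrite /f addrC addKr.
  rewrite normrN; have := HC (res qb U V).
  have : C * `|res qb U V| <= C * (eta / (4 * C)).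
    by rewrite ler_wpM2l ?(ltW C0) // ltW // H1.
  have -> : C * (eta / (4 * C)) = eta / 4 by field; rewrite gt_eqF.
  lra.
- by move=> x y xe ye; apply: half; exact: inr.
exists q; first by lra.
have /eqP : g (res q U V) = 0.
  by move: qE; rewrite /f => /eqP; rewrite subr_eq addrC -subr_eq subrr eq_sym => /eqP.
by move=> /eqP gq; rewrite -(gL (res q U V)) gq -[X in L X](raddf0 g) gL.
Qed.


Ltac goal_lra := clear -gamma1 Um_axis strong Phi1_lax Phi4_lax; lra.

(** K is the inverse differential applied to S'(U_m2) r_4, a constant of the background. The error
    [e * |a4|] has an arbitrarily small factor, while [M] is fixed before [e]. *)
Lemma residual_expansion : exists (K : 'rV[R]_4) (M : R),
  [/\ `|velx K| < 1, 0 < M & forall e : R, 0 < e -> exists2 r : R, 0 < r &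
  forall (U1 U2 V q : 'rV[R]_4) (a2 a3 a4 b1 b2 b3 s : R),
    `|U1 - Um| < r -> `|U2 - Um| < r -> `|V - Ua| < r -> `|q - qb| < r ->
    [/\ `|a2| < r, `|a3| < r & `|a4| < r] ->
    [/\ `|b1| < r, `|b2| < r, `|b3| < r & `|s - s0| < r] ->
    U2 = Phi4 a4 (rescale a2 a3 U1) ->
    res (vec4 b1 b2 b3 s) U2 V = 0 -> res q U1 V = 0 ->
    `|q - vec4 b1 (b2 + a2) (b3 + a3) s - a4 *: K| <=
      e * `|a4| + M * (`|b1| * (`|a2| + `|a3|))].
Proof.
have [g [Lg gL [C C0 HC]]] := strong_diff_inv.
pose w := eigvec gamma 4 Um; pose P := shock_flux_diff gamma s0 Um 0.
have [C2 C20 HC2] := shock_flux_diff_norm_le gamma s0 Um.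
have [M M0 HM] := interaction_estimate Phi1_lax Phi4_lax.
pose K := g (P w).
have K1 : `|velx K| < 1.
  have E : L K = 1 *: P w by rewrite scale1r gL.
  by have [/(_ erefl)] := strong_diff_solve gamma1 Um_axis strong E.
(* [c1] and [c2] measure how far [q0] is from being a zero; [c3] and [c4] add the nonlinearity
   between [q0] and [q]. *)
pose c1 := C2 + `|w| + 1; pose c2 := (C2 + 1) * M.
have c10 : 0 < c1 by rewrite /c1 addr_gt0 // ltr_pwDl.
have c20 : 0 < c2 by rewrite mulr_gt0 // addr_gt0.
have [Ce [re [Ce0 re0 HE]]] := residual_expanding.
pose c3 := C * c1 + C * (Ce * (c1 + C2 * `|w|)).
have c30 : 0 < c3.
  by rewrite addr_gt0 ?mulr_gt0 // ltr_pwDl // mulr_ge0 // ltW.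
pose c4 := C * c2 + C * (Ce * c2).
have c40 : 0 < c4 by rewrite addr_gt0 // mulr_gt0 // mulr_gt0.
exists K, c4; split=> // e e0.
pose e1 := Num.min 1 (e / c3).
have e10 : 0 < e1 by rewrite lt_min ltr01 divr_gt0.
have e11 : e1 <= 1 by rewrite /e1 ge_min lexx.
have e1e : e1 * c3 <= e.
  by rewrite -ler_pdivlMr // /e1 ge_min lexx orbT.
have [qb0 qb1 qb2 qb3] := vec4E 0 0 0 s0.
have [r1 r10 H1] := residual_strict Ua s0 Phi1_lax e10.
have [r2 r20 H2] := shock_flux_strict gamma s0 Um e10.
have [r3 r30 H3] := HM _ e10.
have [r4 r40 H4] := wave_states_continuous Phi1_lax qb0 qb1 qb2 r20.
pose r0 := Num.min (Num.min re r1) (Num.min (Num.min r2 r3) r4).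
have r00 : 0 < r0 by rewrite !lt_min re0 r10 r20 r30.
have small (x : R) : x < r0 -> [/\ x < re, x < r1, x < r2, x < r3 & x < r4].
  by rewrite /r0 !lt_min =>
    /andP[/andP[? ?] /andP[/andP[? ?] ?]].
exists (r0 / 4); first by rewrite divr_gt0.
move=> U1 U2 V q a2 a3 a4 b1 b2 b3 s.
have lt4 (x : R) : x < r0 / 4 -> x < r0 by move: r00; goal_lra.
move=> U1r U2r Vr qr [a2r a3r a4r] [b1r b2r b3r sr] U2E res0 resq.
have half (x : R) : x < r0 / 4 -> x <= r0 / 2 by move: r00; goal_lra.
have half2 (x y : R) : `|x| < r0 / 4 -> `|y| < r0 / 4 -> `|x + y| <= r0 / 2.
  by move=> xr yr; apply: le_trans (ler_normD _ _) _; move: xr yr; goal_lra.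
pose q0 := vec4 b1 (b2 + a2) (b3 + a3) s; pose q1 := vec4 b1 b2 b3 s.
have q0r : `|q0 - qb| < r0.
  apply: (@le_lt_trans _ _ (r0 / 2)); last by move: r00; goal_lra.
  rewrite /q0 vec4B !subr0; apply: vec4_norm_le.
  - exact: half.
  - exact: half2.
  - exact: half2.
  - exact: half.
have q1r : `|q1 - qb| < r0.
  apply: (@le_lt_trans _ _ (r0 / 2)); last by move: r00; goal_lra.
  by rewrite /q1 vec4B !subr0; apply: vec4_norm_le; exact: half.
have [U1e U11 U12 U13 U14] := small _ (lt4 _ U1r).
have [U2e U21 U22 U23 U24] := small _ (lt4 _ U2r).
have [Ve V1 V2 V3 V4] := small _ (lt4 _ Vr).
have [qe q_1 q_2 q_3 q_4] := small _ (lt4 _ qr).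
have [q0e q01 q02 q03 q04] := small _ q0r.
have [q1e q11 q12 q13 q14] := small _ q1r.
have [_ _ s2 _ _] := small _ (lt4 _ sr).
have [_ _ _ a23 _] := small _ (lt4 _ a2r).
have [_ _ _ a33 _] := small _ (lt4 _ a3r).
have [_ _ _ a43 _] := small _ (lt4 _ a4r).
have [_ _ _ b13 _] := small _ (lt4 _ b1r).
have [_ _ _ b23 _] := small _ (lt4 _ b2r).
have [_ _ _ b33 _] := small _ (lt4 _ b3r).
pose Delta := `|b1| * (`|a2| + `|a3|).
have D0 : 0 <= Delta by rewrite mulr_ge0 // addr_ge0.
pose X := wave_states Phi1 q0 U1; pose X' := wave_states Phi1 q1 U2.
have XX : `|X - X' + a4 *: w| <= e1 * `|a4| + M * Delta.
  have := H3 U1 U2 a2 a3 a4 b1 b2 b3 U13 U23.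
  rewrite /X /X' /wave_states /q0 /q1 !vec4K.
  by apply.
have XXn : `|X - X'| <= (`|w| + e1) * `|a4| + M * Delta.
  rewrite -(addrK (a4 *: w) (X - X')); apply: le_trans (ler_normB _ _) _.
  rewrite normrZ; move: XX; goal_lra.
(* [q0] is an approximate zero of the residual. *)
have F0 : `|res q0 U1 V + a4 *: P w| <= e1 * (c1 * `|a4|) + c2 * Delta.
  have -> : res q0 U1 V = shock_flux gamma s X - shock_flux gamma s X'.
    move: res0; rewrite /residual /q0 /q1 !vec4K -/q0 -/q1 -/X -/X' => /eqP.
    by rewrite subr_eq0 => /eqP ->.
  have := H2 s s X X' s2 s2; rewrite subrr normr0 -/(P _).
  rewrite (max_r (normr_ge0 _)) => HS.
  have -> : shock_flux gamma s X - shock_flux gamma s X' + a4 *: P w =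
    (shock_flux gamma s X - shock_flux gamma s X' - P (X - X')) + P (X - X' + a4 *: w).
    by rewrite [P (X - X' + _)]shock_flux_diffD shock_flux_diffZ addrA subrK.
  apply: le_trans (ler_normD _ _) _.
  apply: le_trans (lerD (HS _ _) (HC2 _)) _; [exact: H4..|].
  have T1 := ler_wpM2l (ltW e10) XXn.
  have T2 := ler_wpM2l (ltW C20) XX.
  have T3 : e1 * (e1 * `|a4|) <= e1 * `|a4|.
    by apply: ler_wpM2l; [exact: ltW|rewrite ler_piMl].
  have T4 : e1 * (M * Delta) <= M * Delta.
    by rewrite ler_piMl // mulr_ge0 // ltW.
  by move: T1 T2 T3 T4; rewrite /c1 /c2; goal_lra.
(* An a priori bound linear in |a4| and [Delta]; multiplied by [e1], it makes the nonlinear error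
   admissible. *)
have qq0 : `|q - q0| <= Ce * ((c1 + C2 * `|w|) * `|a4| + c2 * Delta).
  apply: le_trans (HE q q0 U1 V qe q0e U1e Ve) _.
  rewrite ler_wpM2l ?(ltW Ce0) // resq sub0r normrN.
  rewrite -(addrK (a4 *: P w) (res q0 U1 V)).
  apply: le_trans (ler_normB _ _) _; rewrite normrZ.
  have T1 : e1 * (c1 * `|a4|) <= c1 * `|a4|.
    by rewrite ler_piMl // mulr_ge0 // ltW.
  have T2 := ler_wpM2l (normr_ge0 a4) (HC2 w).
  by move: F0 T1 T2; rewrite -/(P w); goal_lra.
have := H1 q q0 U1 V q_1 q01 U11 V1.
rewrite resq sub0r => HL.
(* Inverts the differential on the strict error at [q], [q0] and on the defect of [q0]. *)
have -> : q - q0 - a4 *: K =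
    g (- (- res q0 U1 V - L (q - q0)) - (res q0 U1 V + a4 *: P w)).
  have G x y : g (- (- x - L y) - (x + a4 *: P w)) = g (L y) - a4 *: K.
    rewrite -linearZ -linearB; congr (g _).
    by apply/rowP => i; rewrite !mxE; ring.
  by rewrite G Lg.
apply: le_trans (HC _) _.
apply: (@le_trans _ _ (C * (e1 * `|q - q0| + (e1 * (c1 * `|a4|) + c2 * Delta)))).
  rewrite ler_wpM2l ?(ltW C0) //; apply: le_trans (ler_normB _ _) _.
  by rewrite normrN lerD.
have T1 := ler_wpM2l (ltW e10) qq0.
have T2 : e1 * (Ce * (c2 * Delta)) <= Ce * (c2 * Delta).
  by rewrite ler_piMl // mulr_ge0 ?(ltW Ce0) // mulr_ge0 // ltW.
have T3 : e1 * `|q - q0| + (e1 * (c1 * `|a4|) + c2 * Delta) <=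
    e1 * (c1 + Ce * (c1 + C2 * `|w|)) * `|a4| + (c2 + Ce * c2) * Delta.
  by move: T1 T2; goal_lra.
apply: le_trans (ler_wpM2l (ltW C0) T3) _.
have T4 := ler_wpM2r (normr_ge0 a4) e1e.
by move: T4; rewrite /c3 /c4 -/Delta; goal_lra.
Qed.

Variable G4 : R -> 'rV[R]_4 -> 'rV[R]_4.
Hypothesis G4_shock : strong_shock_map gamma Um Ua s0 G4.

(** A zero satisfies the Rankine-Hugoniot relations; the other shock conditions hold by openness, so
    the uniqueness in [strong_shock_map] identifies the state with [G4 s V]. The 4-wave of strength
    0 is the identity. *)
Lemma strong_waves_residual : exists2 r : R, 0 < r &
  forall (U V : 'rV[R]_4) (d1 d2 d3 s : R),
    `|U - Um| < r -> `|V - Ua| < r ->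
    [/\ `|d1| < r, `|d2| < r, `|d3| < r & `|s - s0| < r] ->
  waves Phi1 Phi4 0 d3 d2 d1 U = G4 s V <-> res (vec4 d1 d2 d3 s) U V = 0.
Proof.
have [qb0 qb1 qb2 qb3] := vec4E 0 0 0 s0.
have [rG [rm [rG0 rm0 HG]]] := G4_shock.
have [r1 r10 H1] := shock4_open gamma1 strong.
have [r2 r20 H2] := lax_curve0 Phi4_lax.
pose r3 := Num.min rm (Num.min r1 r2).
have r30 : 0 < r3 by rewrite !lt_min rm0 r10.
have [r4 r40 H4] := wave_states_continuous Phi1_lax qb0 qb1 qb2 r30.
exists (Num.min (Num.min rG r1) (r4 / 2)).
  by rewrite !lt_min rG0 r10 divr_gt0.
move=> U V d1 d2 d3 s; rewrite !lt_min.
move=> /andP[/andP[UG U1] U4] /andP[/andP[VG V1] V4].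
move=> [/andP[_ d14] /andP[_ d24] /andP[_ d34] /andP[/andP[sG s1] s4]].
pose q := vec4 d1 d2 d3 s; pose X := wave_states Phi1 q U.
have : `|X - Um| < r3.
  apply: H4; last by move: U4 r40; goal_lra.
  apply: (@le_lt_trans _ _ (r4 / 2)); last by move: r40; goal_lra.
  by rewrite vec4B !subr0; apply: vec4_norm_le; exact: ltW.
rewrite !lt_min => /and3P[Xm X1 X2].
have -> : waves Phi1 Phi4 0 d3 d2 d1 U = X.
  by rewrite -[RHS](H2 X X2) /X /wave_states /q !vec4K.
have resE : res q U V = shock_flux gamma s X - shock_flux gamma s V.
  by rewrite /residual -/X /q !vec4K.
have [GX GS GU] := HG s V sG VG.
have [supX supV lam lam2] := H1 s X V s1 X1 V1.
have [_ rX _] := supX; have [_ rV _] := supV.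
have [RHP PRH] := rankine_hugoniotP s gamma1 (lt0r_neq0 rX) (lt0r_neq0 rV).
rewrite -/q resE; split=> [XE|].
  move: GS; rewrite -XE => -[_ _ RH _ _].
  by rewrite RHP // subrr.
by move=> /eqP; rewrite subr_eq0 => /eqP /PRH RH; exact: GU.
Qed.

End strong_interaction.

(** * From norm bounds to interaction coefficients *)

(** The error is shared in proportion to the two parts of its bound. This turns an estimate into the
    exact form K alpha_4 + O(1) Delta. *)
Lemma split_bound (R : realType) (e a eta M Delta : R) : 0 <= eta -> 0 <= M ->
  0 <= Delta -> `|e| <= eta * `|a| + M * Delta ->
  exists x y, [/\ `|x| <= eta, `|y| <= M & e = x * a + y * Delta].
Proof.
move=> eta0 M0 D0 eT; set T := _ + _ in eT.
have T0 : 0 <= T by rewrite addr_ge0 // mulr_ge0.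
have [T00|Tn0] := eqVneq T 0.
  exists 0, 0; rewrite normr0 !mul0r addr0; split=> //.
  by apply/eqP; rewrite -normr_le0 -T00.
have t1 : `|e / T| <= 1.
  by rewrite normrM normfV (ger0_norm T0) ler_pdivrMr ?mul1r // lt0r Tn0.
(* The sign turns |a| back into [a]; [e / T] has absolute value at most 1. *)
exists (e / T * (eta * Num.sg a)), (e / T * M); split.
- rewrite normrM -[leRHS]mul1r; apply: ler_pM => //.
  rewrite normrM (ger0_norm eta0) ler_piMr //.
  by rewrite normr_sg; case: (a != 0).
- by rewrite normrM -[leRHS]mul1r (ger0_norm M0) ler_wpM2r.
rewrite -[LHS](divfK Tn0) /T (normrEsg a); ring.
Qed.

Theorem proposition4p7 (R : realType) (gamma : R) (hgamma : 1 < gamma)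
  (Um2 Ua : 'rV[R]_4) (sigma40 : R)
  (hUm2 : supersonic gamma Um2) (hv : vely Um2 = 0)
  (hUa : supersonic gamma Ua)
  (hshock : shock gamma 4 sigma40 Um2 Ua)
  (Phi1 Phi4 G4 : R -> 'rV[R]_4 -> 'rV[R]_4)
  (hPhi1 : lax_curve gamma 1 Um2 Phi1)
  (hPhi4 : lax_curve gamma 4 Um2 Phi4)
  (hG4 : strong_shock_map gamma Um2 Ua sigma40 G4) :
  exists eta0 M : R, [/\ 0 < eta0, 0 < M &
  forall eta : R, 0 < eta <= eta0 ->
  exists2 epsilon : R, 0 < epsilon &
  forall (U1 U2 U3 : 'rV[R]_4)
    (alpha2 alpha3 alpha4 beta1 beta2 beta3 sigma4 : R),
    `|U1 - Um2| < epsilon -> `|U2 - Um2| < epsilon -> `|U3 - Ua| < epsilon ->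
    weak_waves Phi1 Phi4 eta U1 U2 (0, alpha2, alpha3, alpha4) ->
    strong_waves Phi1 Phi4 G4 sigma40 eta U2 U3
      (beta1, beta2, beta3, sigma4) ->
    (exists! d : R * R * R * R,
       strong_waves Phi1 Phi4 G4 sigma40 eta U1 U3 d) /\
    forall delta1 delta2 delta3 sigma4' : R,
      strong_waves Phi1 Phi4 G4 sigma40 eta U1 U3
        (delta1, delta2, delta3, sigma4') ->
      let Delta := `|beta1| * (`|alpha2| + `|alpha3|) in
      exists K1 K2 K3 K4 O1 O2 O3 O4 : R,
        [/\ [/\ delta1 = beta1 + K1 * alpha4 + O1 * Delta,
                delta2 = beta2 + alpha2 + K2 * alpha4 + O2 * Delta,
                delta3 = beta3 + alpha3 + K3 * alpha4 + O3 * Delta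
              & sigma4' = sigma4 + K4 * alpha4 + O4 * Delta],
            [/\ `|O1| <= M, `|O2| <= M, `|O3| <= M & `|O4| <= M],
            `|K1| < 1
          & `|K2| + `|K3| + `|K4| <= M]].
Proof.
have [K [M [K1 M0 HK]]] :=
  residual_expansion hgamma hv hshock hPhi1 hPhi4.
(* Half the gap below 1: the first coefficient stays below 1 in absolute value after absorbing an
   error of size [theta]. *)
pose theta := (1 - `|velx K|) / 2.
have theta0 : 0 < theta by rewrite divr_gt0 // subr_gt0.
have theta1 : theta <= 1 by rewrite /theta; have := normr_ge0 (velx K); lra.
have [r1 r10 H1] := HK _ theta0.
have [C [r2 [C0 r20 H2]]] := residual_expanding hgamma hv hshock hPhi1.
have [r3 r30 H3] := residual_zero hgamma hv hshock hPhi1.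
have [r4 r40 H4] := strong_waves_residual hgamma hshock hPhi1 hPhi4 hG4.
have [r5 r50 H5] := lax_curve0 hPhi1.
pose r := Num.min (Num.min (Num.min r1 r2) (Num.min r3 r4)) r5.
have r0 : 0 < r by rewrite !lt_min r10 r20 r30 r40.
have small (x : R) : x < r -> [/\ x < r1, x < r2, x < r3, x < r4 & x < r5].
  by rewrite /r !lt_min => /andP[/andP[/andP[-> ->] /andP[-> ->]] ->].
(* Each of the three remaining coefficients is at most [|K| + theta], with [theta <= 1]. Halving [r]
   turns bounds by [eta] into strict bounds by [r]. *)
exists (r / 2), (M + 3 * (`|K| + 1)); split.
- by rewrite divr_gt0.
- by rewrite addr_gt0 // mulr_gt0 // ltr_wpDl.
move=> eta /andP[eta0 etar].
have lt_r (x : R) : x <= eta -> x < r by move: etar r0; clear; lra.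
have [eps1 eps10 Hz] : exists2 eps : R, 0 < eps & forall U V,
    `|U - Um2| < eps -> `|V - Ua| < eps ->
    exists2 q, `|q - vec4 0 0 0 sigma40| < eta & residual gamma Phi1 q U V = 0.
  by apply: H3; have [_ _ e3 _ _] := small _ (lt_r _ (lexx eta)); rewrite eta0 ltW.
exists (Num.min r eps1); first by rewrite lt_min r0.
move=> U1 U2 U3 a2 a3 a4 b1 b2 b3 s.
have minE (x : R) : (x < Num.min r eps1) = (x < r) && (x < eps1) by exact: lt_min.
rewrite !minE => /andP[U1r U1e] /andP[U2r _] /andP[U3r U3e].
move=> [_ a2e a3e a4e U2E] [b1e b2e b3e se /H4 strongE].
have [U11 U12 U13 U14 U15] := small _ U1r.
have [U21 U22 U23 U24 U25] := small _ U2r.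
have [U31 U32 U33 U34 U35] := small _ U3r.
have par (x : R) : x < eta -> [/\ x < r1, x < r2, x < r3, x < r4 & x < r5].
  by move=> /ltW /lt_r /small.
have b4 : [/\ `|b1| < r4, `|b2| < r4, `|b3| < r4 & `|s - sigma40| < r4].
  by split; [case: (par _ b1e)|case: (par _ b2e)|case: (par _ b3e)|case: (par _ se)].
have b5 : [/\ `|b1| < r1, `|b2| < r1, `|b3| < r1 & `|s - sigma40| < r1].
  by split; [case: (par _ b1e)|case: (par _ b2e)|case: (par _ b3e)|case: (par _ se)].
have a5 : [/\ `|a2| < r1, `|a3| < r1 & `|a4| < r1].
  by split; [case: (par _ a2e)|case: (par _ a3e)|case: (par _ a4e)].
have res2 := strongE U24 U34 b4.
(* The incoming 1-wave has strength 0, so [Phi1] drops out. *)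
have {}U2E : U2 = Phi4 a4 (rescale a2 a3 U1).
  by rewrite U2E /waves (H5 U1 U15).
have near_base (d1 d2 d3 s' : R) : `|d1| < eta -> `|d2| < eta -> `|d3| < eta ->
    `|s' - sigma40| < eta ->
    `|vec4 d1 d2 d3 s' - vec4 0 0 0 sigma40| <= eta.
  by move=> *; rewrite vec4B !subr0; apply: vec4_norm_le; exact: ltW.
have resP (d1 d2 d3 s' : R) : `|d1| < eta -> `|d2| < eta -> `|d3| < eta ->
    `|s' - sigma40| < eta ->
    waves Phi1 Phi4 0 d3 d2 d1 U1 = G4 s' U3 <->
    residual gamma Phi1 (vec4 d1 d2 d3 s') U1 U3 = 0.
  move=> e1 e2 e3 e4; apply: H4 => //.
  by split; [case: (par _ e1)|case: (par _ e2)|case: (par _ e3)|case: (par _ e4)].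
split.
  have [q qe resq] := Hz U1 U3 U1e U3e.
  have [z1 z2 z3 z4] := vec4E 0 0 0 sigma40.
  have qz i : `|q 0 i - (vec4 0 0 0 sigma40 : 'rV[R]_4) 0 i| < eta.
    exact: le_lt_trans (entry_dist_le _ _ _) qe.
  have c1 : `|velx q| < eta.
    by have := qz (inord 0); rewrite -/(velx q) -/(velx (vec4 _ _ _ _)) z1 subr0.
  have c2 : `|vely q| < eta.
    by have := qz (inord 1); rewrite -/(vely q) -/(vely (vec4 _ _ _ _)) z2 subr0.
  have c3 : `|pres q| < eta.
    by have := qz (inord 2); rewrite -/(pres q) -/(pres (vec4 _ _ _ _)) z3 subr0.
  have c4 : `|dens q - sigma40| < eta.
    by have := qz (inord 3); rewrite -/(dens q) -/(dens (vec4 _ _ _ _)) z4.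
  exists (velx q, vely q, pres q, dens q); split.
    by split=> //; apply/resP => //; rewrite -stateE.
  move=> [[[d1 d2] d3] s'] [e1 e2 e3 e4 /(resP _ _ _ _ e1 e2 e3 e4) resd].
  (* Two zeros with the same outer states coincide by the expanding estimate. *)
  have qd : q = vec4 d1 d2 d3 s'.
    apply/eqP; rewrite -subr_eq0 -normr_le0.
    have [_ q2 _ _ _] := par _ qe.
    have [_ d2r _ _ _] := small _ (lt_r _ (near_base _ _ _ _ e1 e2 e3 e4)).
    have := H2 q _ U1 U3 q2 d2r U12 U32.
    by rewrite resq resd subrr normr0 mulr0.
  by rewrite qd !vec4K.
move=> d1 d2 d3 s' [e1 e2 e3 e4 /(resP _ _ _ _ e1 e2 e3 e4) resd] Delta.
have [d1r _ _ _ _] := small _ (lt_r _ (near_base _ _ _ _ e1 e2 e3 e4)).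
have := H1 U1 U2 U3 _ a2 a3 a4 b1 b2 b3 s U11 U21 U31 d1r a5 b5 U2E res2 resd.
have KE : a4 *: K =
    vec4 (a4 * velx K) (a4 * vely K) (a4 * pres K) (a4 * dens K).
  by rewrite {1}(stateE K) vec4Z.
rewrite -/Delta vec4B KE vec4B => HD.
have D0 : 0 <= Delta by rewrite mulr_ge0 // addr_ge0.
set v := vec4 _ _ _ _ in HD.
have comp i : `|v 0 i| <= theta * `|a4| + M * Delta.
  exact: le_trans (coord_le_norm _ _) HD.
have [E1 E2 E3 E4] := vec4E (d1 - b1 - a4 * velx K) (d2 - (b2 + a2) - a4 * vely K)
  (d3 - (b3 + a3) - a4 * pres K) (s' - s - a4 * dens K).
have t0 := ltW theta0; have m0 := ltW M0.
have [x1 [y1 [x1b y1b F1]]] := split_bound t0 m0 D0 (comp (inord 0)).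
have [x2 [y2 [x2b y2b F2]]] := split_bound t0 m0 D0 (comp (inord 1)).
have [x3 [y3 [x3b y3b F3]]] := split_bound t0 m0 D0 (comp (inord 2)).
have [x4 [y4 [x4b y4b F4]]] := split_bound t0 m0 D0 (comp (inord 3)).
rewrite -/(velx v) /v E1 in F1; rewrite -/(vely v) /v E2 in F2.
rewrite -/(pres v) /v E3 in F3; rewrite -/(dens v) /v E4 in F4.
have Kx (x k : R) : `|x| <= theta -> `|k + x| <= `|k| + theta.
  by move=> xt; apply: le_trans (ler_normD _ _) _; rewrite lerD2l.
have KK : [/\ `|vely K| <= `|K|, `|pres K| <= `|K| & `|dens K| <= `|K|].
  by split; exact: coord_le_norm.
(* The parts of the error proportional to [a4] move into the coefficients. *)
exists (velx K + x1), (vely K + x2), (pres K + x3), (dens K + x4), y1, y2, y3, y4.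
have MM : M <= M + 3 * (`|K| + 1) by rewrite lerDl mulr_ge0 // addr_ge0.
split.
- by split; [move: F1|move: F2|move: F3|move: F4]; clear; lra.
- split; [exact: (le_trans y1b MM)|exact: (le_trans y2b MM)
    |exact: (le_trans y3b MM)|exact: (le_trans y4b MM)].
- by apply: le_lt_trans (Kx _ _ x1b) _; rewrite /theta; move: K1; clear; lra.
case: KK => k2 k3 k4.
move: (Kx _ (vely K) x2b) (Kx _ (pres K) x3b) (Kx _ (dens K) x4b).
by move: theta1 k2 k3 k4 M0; clear; lra.
Qed.
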